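(* Let $d\geq 2$ be an integer. There exist effectively computable constants $C_1$ and $C_2$, both depending only on $d$, such that \[\left(\frac{1}{2d-1}\right)h_{\mathrm{mc}}(f)-C_1\leq h_{\mathrm{crit}}(f)\leq 4h_{\mathrm{mc}}(f)+C_2\] for all $f\in\mathcal{P}_d(\overline{\mathbb{Q}})$.
   Context: $\mathcal{P}_d$ is the moduli space of polynomials of degree $d$ up to affine conjugacy: $f\sim\psi^{-1}\circ f\circ\psi$ with $\psi(z)=\alpha z+\gamma$, $\alpha\neq 0$. $\mathcal{P}_d(\overline{\mathbb{Q}})$ is the set of affine conjugacy classes (over $\overline{\mathbb{Q}}$) of polynomials of degree $d$ with coefficients in $\overline{\mathbb{Q}}$. Heights. $M_{\mathbb{Q}}$ is the set of usual absolute values on $\mathbb{Q}$ (the archimedean one and the standard $p$-adic ones); an extension of each $|\cdot|_v$ to $\overline{\mathbb{Q}}$ is fixed. For $x_1,\dots,x_n\in\overline{\mathbb{Q}}$, \[h(x_1,\dots,x_n)=\frac{1}{[E:\mathbb{Q}]}\sum_{\sigma\in\operatorname{Gal}(E/\mathbb{Q})}\sum_{v\in M_{\mathbb{Q}}}\log\max\{1,|\sigma(x_1)|_v,\dots,|\sigma(x_n)|_v\}\] for any finite Galois extension $E/\mathbb{Q}$ containing $x_1,\dots,x_n$. Monic centred height. Every polynomial of degree $d$ over $\overline{\mathbb{Q}}$ is affine-conjugate to some $z^d+a_{d-2}z^{d-2}+\cdots+a_1z+a_0$, and any two such representatives differ by a conjugacy $z\mapsto\zeta z$ with $\zeta^{d-1}=1$.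 Define $h_{\mathrm{mc}}$ of the class by $h_{\mathrm{mc}}(z^d+a_{d-2}z^{d-2}+\cdots+a_0)=h(a_{d-2},\dots,a_0)$; this is well defined on conjugacy classes. Critical height. For $f\in\overline{\mathbb{Q}}[z]$ of degree $d$, the canonical height is $\hat h_f(z)=\lim_{N\to\infty}d^{-N}h(f^N(z))$ for $z\in\overline{\mathbb{Q}}$ ($f^N$ the $N$-th iterate), and $\hat h_f(\infty)=0$. Then \[h_{\mathrm{crit}}(f)=\sum_{P\in\mathbb{P}^1(\overline{\mathbb{Q}})}(e_P(f)-1)\hat h_f(P),\] where $e_P(f)$ is the ramification index of $f$ at $P$; equivalently, it is the sum of $\hat h_f(c)$ over the finite critical points $c$ of $f$ counted with multiplicity. It is invariant under affine conjugacy, so is a function on $\mathcal{P}_d(\overline{\mathbb{Q}})$. *)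

(* Defs.v *)
From HB Require Import structures.
From mathcomp Require Import all_boot all_order all_algebra all_fingroup all_field.
From mathcomp Require Import generic_quotient ring.
From mathcomp Require Import all_classical all_reals all_analysis.

Set Implicit Arguments.
Unset Strict Implicit.
Unset Printing Implicit Defensive.

Import Order.TTheory GRing.Theory Num.Theory.
Import numFieldNormedType.Exports.

Local Open Scope classical_set_scope.
Local Open Scope ring_scope.

(** * Effective computability *)

(* The total recursive functions.  Minimisation is applied only to regular
   functions, so every function in the class is total, and the class consists
   of exactly the total computable functions. *)
Inductive recursive : forall n : nat, (n.-tuple nat -> nat) -> Prop :=
| Rec_zero n : @recursive n (fun=> 0%N)
| Rec_succ : @recursive 1 (fun t => (thead t).+1)
| Rec_proj n (i : 'I_n) : @recursive n (fun t => tnth t i)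
| Rec_comp m n (f : m.-tuple nat -> nat) (g : 'I_m -> n.-tuple nat -> nat) :
    recursive f -> (forall i, recursive (g i)) ->
    @recursive n (fun t => f [tuple g i t | i < m])
| Rec_prim n (f : n.-tuple nat -> nat) (g : n.+2.-tuple nat -> nat)
    (h : n.+1.-tuple nat -> nat) :
    recursive f -> recursive g ->
    (forall t, h (cons_tuple 0%N t) = f t) ->
    (forall k t, h (cons_tuple k.+1 t) =
       g (cons_tuple k (cons_tuple (h (cons_tuple k t)) t))) ->
    recursive h
| Rec_mu n (f : n.+1.-tuple nat -> nat) (h : n.-tuple nat -> nat) :
    recursive f ->
    (forall t, f (cons_tuple (h t) t) = 0%N) ->
    (forall t k, (k < h t)%N -> f (cons_tuple k t) <> 0%N) ->
    recursive h.

(* A real-valued function of a natural number is effectively computable when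
   some algorithm, given d and k, outputs a rational number (encoded as
   (a - b) / (c + 1) with a, b, c natural numbers) within 2 ^ -k of C d. *)
Definition effectively_computable (R : realType) (C : nat -> R) : Prop :=
  exists a b c : 2.-tuple nat -> nat,
    [/\ recursive a, recursive b, recursive c &
      forall d k : nat, let t := [tuple d; k] in
        `|C d - ((a t)%:R - (b t)%:R) / (c t).+1%:R| <= 2%:R ^- k].

(** * Heights on algC, the field of algebraic numbers *)

(* M_Q: None is the archimedean place, Some p the p-adic one. *)
Definition place := option {p : nat | prime p}.

Definition abs_rat (R : realType) (v : place) (q : rat) : R :=
  match v with
  | None => `|ratr q|
  | Some p =>
      if q == 0 then 0
      else (val p)%:R ^ ((logn (val p) `|denq q|)%:Z
                         - (logn (val p) `|numq q|)%:Z)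
  end.

Record abs_extension (R : realType) (v : place) (a : algC -> R) : Prop := {
  abs_ext_ge0 : forall x, 0 <= a x;
  abs_ext_eq0 : forall x, a x = 0 <-> x = 0;
  abs_extM : forall x y, a (x * y) = a x * a y;
  abs_extD : forall x y, a (x + y) <= a x + a y;
  abs_ext_rat : forall q : rat, a (ratr q) = abs_rat R v q
}.

(* A splittingFieldType rat is the same thing as a finite Galois extension of
   Q, since the characteristic is 0; its embedding in algC is explicit. *)
Lemma galois_field_exists (xs : seq algC) :
  {E : splittingFieldType rat &
    {iota : {rmorphism E -> algC} & {ys : seq E | map iota ys = xs}}}.
Proof.
pose P := \prod_(x <- xs) sval (minCpolyP x).
have monP : P \is monic.
  by apply: monic_prod => x _; case: (minCpolyP x) => p [].
have rootP' x : x \in xs -> root (map_poly ratr P) x.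
  move=> xxs; rewrite /P (big_rem x xxs) /= rmorphM rootM.
  by case: (minCpolyP x) => p [_ _] /= /(_ p); rewrite dvdpp => ->.
have [r Dr] := closed_field_poly_normal (map_poly ratr P : {poly algC}).
rewrite lead_coef_map (monicP monP) rmorph1 scale1r in Dr.
have [E [iota [rr Drr genE]]] := num_field_exists r.
have splitE : splitting_field_axiom E.
  exists (map_poly (in_alg E) P).
    by apply/polyOverP=> i; rewrite coef_map memvZ ?memv_line.
  exists rr => //; congr (_ %= _): (eqpxx (map_poly (in_alg E) P)).
  apply/(map_poly_inj iota); rewrite -map_poly_comp.
  rewrite (@eq_map_poly _ _ _ ratr); last first.
    by move=> a /=; rewrite rmorphZ_num rmorph1 mulr1.
  rewrite Dr -Drr big_map rmorph_prod /=.
  by apply: eq_bigr => y _; rewrite map_polyXsubC.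
pose EM := FieldExt_isSplittingField.Build _ E splitE.
pose ES : splittingFieldType rat := HB.pack (GRing.Field.sort E) EM.
exists ES, iota; exists [seq (nth 0 rr (index x r) : ES) | x <- xs].
rewrite -map_comp -[RHS]map_id; apply/eq_in_map => x xxs /=.
have xr : x \in r by rewrite -root_prod_XsubC -Dr rootP'.
have lt_i : (index x r < size rr)%N by rewrite -(size_map iota) Drr index_mem.
by rewrite -(nth_map 0 0) // Drr nth_index.
Qed.

Section Heights.

Variables (R : realType) (abs : place -> algC -> R).

Definition height_in (E : splittingFieldType rat) (iota : {rmorphism E -> algC})
    (ys : seq E) : R :=
  (\dim {:E})%:R^-1 *
  \sum_(s in 'Gal({:E} / 1%VS)%g)
    \sum_(v \in [set: place])
      ln (\big[Num.max/1]_(y <- ys) abs v (iota (s y))).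

(* Any Galois number field containing xs gives the same value; one is picked
   by galois_field_exists. *)
Definition height (xs : seq algC) : R :=
  let: existT E (existT iota (exist ys _)) := galois_field_exists xs in
  height_in iota ys.

Definition canonical_height (f : {poly algC}) (z : algC) : R :=
  limn (fun N : nat =>
    ((size f).-1%:R ^- N * height [:: iter N (fun w => f.[w]) z] : R)).

(* P^1(algC) is option algC, with None the point at infinity. *)
Definition canonical_height_P1 (f : {poly algC}) (P : option algC) : R :=
  match P with
  | Some z => canonical_height f z
  | None => 0
  end.

End Heights.

(* A polynomial is totally ramified at infinity. *)
Definition ramification_index (f : {poly algC}) (P : option algC) : nat :=
  match P with
  | Some z => mup z (f - f.[z]%:P)
  | None => (size f).-1
  end.

Definition critical_height_poly (R : realType) (abs : place -> algC -> R)
    (f : {poly algC}) : R :=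
  \sum_(P \in [set: option algC])
    ((ramification_index f P)%:R - 1) * canonical_height_P1 abs f P.

(** * The moduli space of polynomials of degree d *)

Definition affine (a c : algC) : {poly algC} := a *: 'X + c%:P.

Definition affine_inv (a c : algC) : {poly algC} := affine a^-1 (- (a^-1 * c)).

Lemma affine_comp a c a' c' :
  affine a c \Po affine a' c' = affine (a * a') (a * c' + c).
Proof.
rewrite /affine comp_polyD comp_polyC comp_polyZ comp_polyX scalerDr scalerA.
by rewrite -addrA polyCD polyCM mul_polyC.
Qed.

Lemma affine_invl a c : a != 0 -> affine_inv a c \Po affine a c = 'X.
Proof.
by move=> a0; rewrite affine_comp mulVf // subrr /affine scale1r addr0.
Qed.

Lemma affine_invr a c : a != 0 -> affine a c \Po affine_inv a c = 'X.
Proof.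
move=> a0; rewrite affine_comp mulfV // mulrN mulrA mulfV // mul1r addNr.
by rewrite /affine scale1r addr0.
Qed.

Definition conjugate (a c : algC) (f : {poly algC}) : {poly algC} :=
  affine_inv a c \Po (f \Po affine a c).

Section Moduli.

Variable d : nat.

Definition poly_of_degree := {f : {poly algC} | size f == d.+1}.

Definition affine_conj : rel poly_of_degree := fun f g =>
  `[< exists a c : algC, a != 0 /\ val g = conjugate a c (val f) >].

Lemma affine_conj_refl : reflexive affine_conj.
Proof.
move=> f; apply/asboolP; exists 1, 0; split; first exact: oner_neq0.
by rewrite /conjugate /affine_inv /affine invr1 mulr0 oppr0 scale1r addr0
  comp_polyX comp_polyXr.
Qed.

Lemma affine_conj_sym : symmetric affine_conj.
Proof.
suff sub f g : affine_conj f g -> affine_conj g f.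
  by move=> f g; apply/idP/idP; apply: sub.
case/asboolP=> a [c [a0 Dg]]; apply/asboolP; exists a^-1, (- (a^-1 * c)).
split; first by rewrite invr_eq0.
have inv2 : affine_inv a^-1 (- (a^-1 * c)) = affine a c.
  by rewrite /affine_inv invrK mulrN opprK mulrA mulfV // mul1r.
rewrite Dg /conjugate inv2 -/(affine_inv a c) !comp_polyA affine_invr //.
by rewrite comp_polyX -comp_polyA affine_invr // comp_polyXr.
Qed.

Lemma affine_conj_trans : transitive affine_conj.
Proof.
move=> g f h /asboolP[a [c [a0 Dg]]] /asboolP[b [e [b0 Dh]]].
apply/asboolP; exists (a * b), (a * e + c); split; first by rewrite mulf_neq0.
rewrite Dh Dg /conjugate -affine_comp !comp_polyA; congr (_ \Po _ \Po _ \Po _).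
rewrite /affine_inv affine_comp; congr affine; field; by rewrite ?a0 ?b0.
Qed.

Canonical affine_conj_equiv :=
  EquivRel affine_conj affine_conj_refl affine_conj_sym affine_conj_trans.

(* The space P_d(Qbar) of affine conjugacy classes. *)
Definition moduli := {eq_quot affine_conj}%qT.

Definition monic_centred (g : poly_of_degree) : Prop :=
  (val g \is monic) /\ (val g)`_d.-1 = 0.

Definition mc_repr (F : moduli) : poly_of_degree :=
  xget (repr F) [set g | monic_centred g /\ \pi_moduli%qT g = F].

Lemma mc_reprP (F : moduli) : (1 < d)%N ->
  monic_centred (mc_repr F) /\ \pi_moduli%qT (mc_repr F) = F.
Proof.
move=> d1; apply: (@xgetPex _ (repr F)
  [set g | monic_centred g /\ \pi_moduli%qT g = F]).
have d0 : (0 < d)%N by apply: ltn_trans d1.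
have d10 : (0 < d.-1)%N by rewrite -ltnS prednK.
set f := repr F; pose p := val f; have szp : size p = d.+1 := eqP (valP f).
have lp0 : p`_d != 0.
  by rewrite -[d]/(d.+1.-1) -szp -lead_coefE lead_coef_eq0 -size_poly_eq0 szp.
pose a := d.-1.-root (p`_d)^-1.
have aX : a ^+ d.-1 = (p`_d)^-1 by rewrite rootCK.
have a0 : a != 0.
  by apply: contraNneq lp0 => a0; rewrite -invr_eq0 -aX a0 expr0n (gtn_eqF d10).
have dR0 : (d%:R : algC) != 0 by rewrite pnatr_eq0 -lt0n.
pose e := - p`_d.-1 / (p`_d * a * d%:R); pose c := a * e.
pose q := p \Po affine a c.
have Daff : affine a c = a *: ('X - (- e)%:P).
  by rewrite /affine polyCN opprK scalerDr /c polyCM mul_polyC.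
have cq k : q`_k = \sum_(0 <= i < d.+1) p`_i * (a ^+ i * (('X - (- e)%:P) ^+ i)`_k).
  rewrite /q comp_polyE szp coef_sum big_mkord; apply: eq_bigr => i _.
  by rewrite Daff exprZn !coefZ.
have szX i : size (('X - (- e)%:P) ^+ i : {poly algC}) = i.+1.
  by rewrite size_exp_XsubC.
have topX i : (('X - (- e)%:P) ^+ i : {poly algC})`_i = 1.
  have := monic_exp i (monicXsubC (- e)).
  by rewrite monicE lead_coefE szX => /eqP.
have q_d : q`_d = a.
  rewrite cq big_nat_recr //= big_nat big1 ?add0r => [|i /andP[_ i_lt]]; last first.
    by rewrite [X in _ * (_ * X)]nth_default ?mulr0 // szX.
  by rewrite topX mulr1 -{2}(prednK d0) exprS aX mulrCA mulfV ?mulr1.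
have q_d1 : q`_d.-1 = 0.
  rewrite cq big_nat_recr //= -[X in \sum_(0 <= _ < X) _](prednK d0).
  rewrite big_nat_recr //= big_nat big1 ?add0r => [|i /andP[_ i_lt]]; last first.
    by rewrite [X in _ * (_ * X)]nth_default ?mulr0 // szX.
  have -> : (('X - (- e)%:P) ^+ d : {poly algC})`_d.-1 = d%:R * e.
    have := @coefPn_prod_XsubC algC (nseq d (- e)).
    rewrite size_nseq -lt0n d0 => /(_ isT).
    by rewrite !big_nseq iter_mulr_1 iter_addr_0 mulNrn opprK mulr_natl.
  rewrite topX.
  rewrite mulr1 -(prednK d0) exprS prednK // /e; field.
  by rewrite dR0 a0 lp0.
have Dg k : (conjugate a c p)`_k = a^-1 * q`_k + (- (a^-1 * c)) *+ (k == 0%N).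
  rewrite /conjugate -/q /affine_inv {1}/affine comp_polyD comp_polyZ comp_polyX.
  by rewrite comp_polyC coefD coefZ coefC; case: (k == 0%N); rewrite ?mulr0n.
have szq : size (conjugate a c p) = d.+1.
  have sza : size (affine a c) = 2%N by rewrite Daff size_scale ?size_XsubC.
  have sza' : size (affine_inv a c) = 2%N.
    by rewrite /affine_inv /affine size_polyDl ?size_scale ?size_polyX ?invr_eq0
      // (leq_ltn_trans (size_polyC_leq1 _)).
  have szq : size q = d.+1 by rewrite size_comp_poly2.
  have := size_comp_poly (affine_inv a c) q; rewrite sza' szq mul1n /=.
  rewrite /conjugate -/q; case: (size _) => [|n] /= Dn; last by rewrite Dn.
  by move: (d0); rewrite -Dn.
have szqP : size (conjugate a c p) == d.+1 by rewrite szq.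
exists (exist _ (conjugate a c p) szqP); split; last first.
  rewrite -[RHS]reprK; apply/eqmodP; rewrite /= affine_conj_sym.
  by apply/asboolP; exists a, c.
split => /=.
  by rewrite monicE lead_coefE szq Dg q_d mulVf // gtn_eqF ?addr0.
by rewrite Dg q_d1 mulr0 gtn_eqF ?addr0.
Qed.

End Moduli.

(* z^d + a_(d-2) z^(d-2) + ... + a_0 is sent to h(a_(d-2), ..., a_0). *)
Definition h_mc (R : realType) (abs : place -> algC -> R) (d : nat)
    (F : moduli d) : R :=
  height abs [seq (val (mc_repr F))`_i | i <- rev (iota 0 d.-1)].

(* critical_height_poly is invariant under affine conjugacy, so the choice of
   representative is immaterial. *)
Definition h_crit (R : realType) (abs : place -> algC -> R) (d : nat)
    (F : moduli d) : R :=
  critical_height_poly abs (val (repr F)).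

(* Main.v *)
From mathcomp Require Import all_boot all_order all_algebra all_fingroup all_field.
From mathcomp Require Import generic_quotient ring lra zify.
From mathcomp Require Import all_classical all_reals all_analysis.
Require Import Defs.

Set Implicit Arguments.
Unset Strict Implicit.
Unset Printing Implicit Defensive.

Import Order.TTheory GRing.Theory Num.Theory.
Import numFieldNormedType.Exports.

Local Open Scope ring_scope.

(** Let g be a monic centred polynomial of degree d, with roots r and critical
    points c. Both inequalities are proved one absolute value at a time, and
    then summed; the bounds so obtained are
    h(g) / d - C1 <= sum of the canonical heights of the c <= 2 h(g) + C2.

    Lower bound. The coefficients of g are symmetric functions of its roots, so
    h(g) <= d h(r) + O(1) ([height_le_roots]). The main point is that at every
    absolute value some critical point c satisfies |g(c)| >= max |r|^d up to a
    bounded factor ([critical_value]). Once |g(c)| is that large the orbit of c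
    escapes, and d^(-k) log |g^k(c)| stays above log max |r| - O(1)
    ([critical_escape]). Dropping the other, nonnegative, terms and summing over
    the absolute values gives h(r) - O(1) as a lower bound for the sum of the
    canonical heights of the critical points ([sum_height_orbit_ge]).

    The reason for the main point is visible in the extreme case where all
    critical values are 0. Then each critical point is a root, and a root of
    multiplicity m is a critical point of multiplicity m - 1, so d roots of
    which s are distinct give d - s critical points; since there are d - 1, all
    roots coincide, and they are 0 because their sum is 0. For small instead of
    zero critical values the same count is made with clusters of roots: a
    cluster of m roots, well separated from the others, has at most m - 1
    critical points near it ([cluster_bound]), and the pigeonhole principle
    provides a scale at which the clusters are well separated ([empty_gap]).

    Upper bound. The inequality of Mahler for the roots of the derivative bounds
    the sum of the h(c) by h(g) + O(1) ([sum_height_critical_le]). From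
    h(g(z)) <= d h(z) + h(g) + O(1) the canonical height of z exceeds h(z) by at
    most (h(g) + O(1)) / (d - 1), and there are d - 1 critical points.

    Heights. Averages over Galois groups do not depend on the chosen field, and
    extending Galois automorphisms to algC turns the height of the elements of a
    fixed number field into a normalised sum over absolute values of algC, only
    finitely many of which matter ([height_finite_sum]). Nothing is used of them
    except that they extend absolute values of the rationals.

    Error terms. All estimates hold with an error that is a multiple, depending
    on d only, of log N, where |x + y| <= N max(|x|, |y|) and the integers up to
    d have absolute value at least N^(-d). One can take N = 1 at the primes p > d
    and N = 2 at the other places, of which there are at most d + 2. The total
    errors are therefore explicit natural numbers, computed from d by sums,
    products and powers. *)

(** * Computability of the constants *)

Lemma eq_recursive n (f g : n.-tuple nat -> nat) :
  recursive f -> f =1 g -> recursive g.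
Proof. by move=> rec_f /funext <-. Qed.

Lemma recursive_comp1 n (f : 1.-tuple nat -> nat) (g : n.-tuple nat -> nat) :
  recursive f -> recursive g -> recursive (fun t => f [tuple g t]).
Proof.
move=> rec_f rec_g; apply: (eq_recursive (Rec_comp (g := fun=> g) rec_f _)) => //.
by move=> t; congr f; apply: eq_from_tnth => i; rewrite tnth_mktuple (tnth_nth 0%N) (ord1 i).
Qed.

Lemma recursive_comp2 n (f : 2.-tuple nat -> nat) (g h : n.-tuple nat -> nat) :
  recursive f -> recursive g -> recursive h ->
  recursive (fun t => f [tuple g t; h t]).
Proof.
move=> rec_f rec_g rec_h.
have rec_gh (i : 'I_2) : recursive (if i == 0 then g else h) by case: ifP.
apply: (eq_recursive (Rec_comp rec_f rec_gh)) => t.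
congr f; apply: eq_from_tnth => i; rewrite tnth_mktuple (tnth_nth 0%N).
by case: i => [[|[|]]].
Qed.

Lemma recursive_succ n (f : n.-tuple nat -> nat) :
  recursive f -> recursive (fun t => (f t).+1).
Proof. exact: (recursive_comp1 Rec_succ). Qed.

Lemma recursive_const n k : recursive (fun=> k : nat) (n := n).
Proof.
elim: k => [|k IHk]; first exact: Rec_zero.
exact: recursive_succ IHk.
Qed.

(** Primitive recursion in the first of two variables, in the form in which
    addition, multiplication and exponentiation are iterations. *)
Lemma recursive_iter (F : nat -> nat -> nat) (f : nat -> nat)
    (g : 2.-tuple nat -> nat) :
  recursive (fun t : 1.-tuple nat => f (thead t)) -> recursive g ->
  (forall y, F 0%N y = f y) ->
  (forall k y, F k.+1 y = g [tuple F k y; y]) ->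
  recursive (fun t : 2.-tuple nat => F (thead t) (tnth t (lift ord0 ord0))).
Proof.
move=> rec_f rec_g F0 FS.
have rec_G : recursive (fun t : 3.-tuple nat =>
    g [tuple tnth t (lift ord0 ord0); tnth t (lift ord0 (lift ord0 ord0))]).
  by apply: recursive_comp2 => //; exact: Rec_proj.
apply: (Rec_prim rec_f rec_G) => [t|k t] /=.
  by rewrite F0 /thead !(tnth_nth 0%N).
by rewrite /thead !(tnth_nth 0%N) /= FS; case: t => -[|y []].
Qed.

Lemma recursive_binary n (F : nat -> nat -> nat) (g h : n.-tuple nat -> nat) :
  recursive (fun t : 2.-tuple nat => F (thead t) (tnth t (lift ord0 ord0))) ->
  recursive g -> recursive h -> recursive (fun t => F (g t) (h t)).
Proof.
by move=> rec_F rec_g rec_h; apply: (eq_recursive (recursive_comp2 rec_F rec_g rec_h)).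
Qed.

Lemma recursive_add n (g h : n.-tuple nat -> nat) :
  recursive g -> recursive h -> recursive (fun t => g t + h t)%N.
Proof.
apply: recursive_binary.
apply: (@recursive_iter addn id (fun t => (thead t).+1)).
- exact: Rec_proj.
- by apply: (eq_recursive (recursive_succ (Rec_proj ord0))).
- by [].
- by [].
Qed.

Lemma recursive_mul n (g h : n.-tuple nat -> nat) :
  recursive g -> recursive h -> recursive (fun t => g t * h t)%N.
Proof.
apply: recursive_binary.
apply: (@recursive_iter muln (fun=> 0%N)
  (fun t => thead t + tnth t (lift ord0 ord0))%N).
- exact: Rec_zero.
- by apply: recursive_add; exact: Rec_proj.
- by [].
- by move=> k y; rewrite mulSn addnC.
Qed.

Lemma recursive_exp n (g h : n.-tuple nat -> nat) :
  recursive g -> recursive h -> recursive (fun t => g t ^ h t)%N.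
Proof.
move=> rec_g rec_h; apply: (@recursive_binary n (fun e m => m ^ e)%N) => //.
apply: (@recursive_iter (fun e m => m ^ e)%N (fun=> 1%N)
  (fun t => thead t * tnth t (lift ord0 ord0))%N).
- exact: recursive_const.
- by apply: recursive_mul; exact: Rec_proj.
- by [].
- by move=> k y; rewrite expnS mulnC.
Qed.

Lemma nat_effectively_computable (R : realType) (c : nat -> nat) :
  recursive (fun t : 2.-tuple nat => c (thead t)) ->
  effectively_computable (fun d => (c d)%:R : R).
Proof.
move=> rec_c; exists (fun t => c (thead t)), (fun=> 0%N), (fun=> 0%N).
split; [by []|exact: Rec_zero|exact: Rec_zero|move=> d k /=].
by rewrite theadE subr0 divr1 subrr normr0 invr_ge0 exprn_ge0.
Qed.

(** * Absolute values satisfying the ultrametric inequality up to a factor *)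

(** The factor N allows one argument for all places: N = 1 is the ultrametric
    inequality, while the ordinary triangle inequality gives N = 2. Every
    estimate below loses only a power of N, hence nothing when N = 1. *)
Record quasi_abs (R : realFieldType) (K : fieldType) (N : R) (a : K -> R) :
    Prop := QuasiAbs {
  qabs_ge1 : 1 <= N;
  qabs_ge0 : forall x, 0 <= a x;
  qabs_eq0 : forall x, a x = 0 <-> x = 0;
  qabsM : forall x y, a (x * y) = a x * a y;
  qabsD : forall x y, a (x + y) <= N * Num.max (a x) (a y) }.

Section QuasiAbs.

Variables (R : realFieldType) (K : fieldType) (N : R) (a : K -> R).
Hypothesis qa : quasi_abs N a.

Let N1 : 1 <= N := qabs_ge1 qa.
Let a_ge0 x : 0 <= a x := qabs_ge0 qa x.

Let N0 : 0 <= N. Proof. exact: le_trans ler01 N1. Qed.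
Let Ngt0 : 0 < N. Proof. exact: lt_le_trans ltr01 N1. Qed.
Let NX1 n : 1 <= N ^+ n. Proof. exact: exprn_ege1. Qed.
Let NX0 n : 0 <= N ^+ n. Proof. exact: exprn_ge0. Qed.

Lemma qabs0 : a 0 = 0. Proof. exact/(qabs_eq0 qa). Qed.

Lemma qabs_neq0 x : x != 0 -> a x != 0.
Proof. by apply: contra_neq => /(qabs_eq0 qa). Qed.

Lemma qabs1 : a 1 = 1.
Proof.
have a1n0 := qabs_neq0 (oner_neq0 K).
by apply: (mulfI a1n0); rewrite -(qabsM qa) !mulr1.
Qed.

Lemma qabsN x : a (- x) = a x.
Proof.
suff aN1 : a (-1) = 1 by rewrite -mulN1r (qabsM qa) aN1 mul1r.
apply/eqP; rewrite -(@pexpr_eq1 _ _ 2) //.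
by rewrite expr2 -(qabsM qa) mulrNN mulr1 qabs1.
Qed.

Lemma qabs_subC x y : a (x - y) = a (y - x).
Proof. by rewrite -qabsN opprB. Qed.

Lemma qabsX x n : a (x ^+ n) = a x ^+ n.
Proof. by elim: n => [|n IHn]; rewrite ?expr0 ?qabs1 // !exprS (qabsM qa) IHn. Qed.

Lemma qabsV x : a x^-1 = (a x)^-1.
Proof.
have [->|xn0] := eqVneq x 0; first by rewrite invr0 qabs0 invr0.
have axn0 := qabs_neq0 xn0.
by apply: (mulfI axn0); rewrite -(qabsM qa) !mulfV // qabs1.
Qed.

Lemma qabs_prod (I : Type) (s : seq I) (P : pred I) F :
  a (\prod_(i <- s | P i) F i) = \prod_(i <- s | P i) a (F i).
Proof. by apply: (big_morph a (qabsM qa) qabs1). Qed.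

Lemma qabsD_le x y M : a x <= M -> a y <= M -> a (x + y) <= N * M.
Proof.
move=> ax ay; apply: le_trans (qabsD qa x y) _.
by rewrite ler_pM2l // ge_max ax.
Qed.

Lemma qabsB_le x y M : a x <= M -> a y <= M -> a (x - y) <= N * M.
Proof. by move=> ax ay; apply: qabsD_le; rewrite ?qabsN. Qed.

Lemma qabs_sum (I : eqType) (s : seq I) F M : 0 <= M ->
  (forall i, i \in s -> a (F i) <= M) ->
  a (\sum_(i <- s) F i) <= N ^+ (size s) * M.
Proof.
move=> M0; elim: s => [|i s IHs] aF /=.
  by rewrite big_nil qabs0 expr0 mul1r.
rewrite big_cons exprS -mulrA; apply: qabsD_le.
  by apply: le_trans (aF i (mem_head _ _)) _; rewrite ler_peMl.
by apply: IHs => j js; apply: aF; rewrite inE js orbT.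
Qed.

Lemma qabs_sum_ord n (F : 'I_n -> K) M : 0 <= M ->
  (forall i, a (F i) <= M) -> a (\sum_(i < n) F i) <= N ^+ n * M.
Proof.
move=> M0 aF; rewrite -[X in N ^+ X]size_enum_ord -big_enum.
by apply: qabs_sum => // i _.
Qed.

Lemma qabs_nat n : a n%:R <= N ^+ n.
Proof.
rewrite -[n]card_ord -sumr_const card_ord -[leRHS]mulr1.
by apply: qabs_sum_ord => // i; rewrite qabs1.
Qed.

Lemma coef_prod_XsubC_le (rs : seq K) (rho : R) k : 0 <= rho ->
  (forall r, r \in rs -> a r <= rho) ->
  a (\prod_(r <- rs) ('X - r%:P))`_k <= N ^+ size rs * rho ^+ (size rs - k).
Proof.
move=> rho0; elim: rs k => [|r rs IHrs] k a_rs /=.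
  by rewrite big_nil coef1; case: k => [|k]; rewrite /= ?qabs1 ?qabs0 ?expr0 ?mulr1.
have {}IHrs := IHrs _ (fun x xs => a_rs x (mem_behead (s := r :: rs) xs)).
have ar : a r <= rho by apply: a_rs; rewrite mem_head.
rewrite big_cons mulrBl coefB coefXM coefCM exprS -mulrA.
case: k => [|k] /=.
  rewrite sub0r qabsN (qabsM qa) subn0 exprSr.
  have := IHrs 0%N; rewrite subn0 => le0.
  apply: le_trans (ler_pM (a_ge0 _) (a_ge0 _) ar le0) _.
  rewrite [_ * rho]mulrC mulrCA ler_peMl // !mulr_ge0 ?exprn_ge0 //.
rewrite subSS; apply: qabsB_le; first exact: IHrs.
have [k_lt|k_ge] := ltnP k (size rs); last first.
  rewrite nth_default ?mulr0 ?qabs0 ?mulr_ge0 ?exprn_ge0 //.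
  by rewrite size_prod_XsubC.
rewrite (qabsM qa) -(subnSK k_lt) exprS mulrCA.
by apply: ler_pM.
Qed.

(** Let m be the number of roots ds, of size at most rho. The coefficient of z^m
    is close to the product of the remaining roots, up to sign; when at least m
    zeros of the derivative are as small as the ds, the coefficient of z^(m-1) of
    the derivative is small. The latter coefficient is m times the former. The
    bounds N and N^2 are those of roots and critical points that have been
    translated after the largest root was scaled to absolute value 1. *)
Lemma cluster_bound (ds fs bs hs : seq K) (rho : R) (d : nat) :
  d = (size ds + size fs)%N ->
  0 <= rho <= 1 -> (0 < size ds)%N ->
  (forall r, r \in ds -> a r <= rho) ->
  (forall r, r \in fs -> a r <= N) ->
  (forall c, c \in bs -> a c <= N * rho) ->
  (forall c, c \in hs -> a c <= N ^+ 2) ->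
  (size ds <= size bs)%N -> (size bs + size hs).+1 = d ->
  1 <= N ^+ d * a (size ds)%:R ->
  (\prod_(r <- ds) ('X - r%:P) * \prod_(r <- fs) ('X - r%:P))^`() =
    d%:R *: (\prod_(c <- bs) ('X - c%:P) * \prod_(c <- hs) ('X - c%:P)) ->
  \prod_(r <- fs) a r <= N ^+ (7 * d) * rho.
Proof.
move=> Dd /andP[rho0 rho1] ds_gt0 a_ds a_fs a_bs a_hs ds_bs sz_d am der_eq.
have NW i j : (i <= j)%N -> N ^+ i <= N ^+ j by move=> ij; apply: ler_weXn2l.
set p := size ds in Dd ds_gt0 ds_bs am *; set q := size fs in Dd *.
set D := \prod_(r <- ds) _ in der_eq; set F := \prod_(r <- fs) _ in der_eq.
set B := \prod_(c <- bs) _ in der_eq; set H := \prod_(c <- hs) _ in der_eq.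
have Dp : D`_p = 1.
  have := monic_prod_XsubC ds xpredT id; rewrite monicE lead_coefE.
  by rewrite size_prod_XsubC => /eqP.
have F0 : a F`_0 = \prod_(r <- fs) a r.
  rewrite /F -horner_coef0 horner_prod (qabs_prod) //.
  by apply: eq_bigr => r _; rewrite hornerXsubC sub0r qabsN.
have D_le (j : 'I_p) : a D`_j <= N ^+ p * rho.
  apply: le_trans (coef_prod_XsubC_le j rho0 a_ds) _.
  rewrite ler_wpM2l // -/p -(subnSK (ltn_ord j)) exprS ler_piMr //.
  by rewrite exprn_ile1.
have F_le k : a F`_k <= N ^+ (2 * q).
  apply: le_trans (coef_prod_XsubC_le k N0 a_fs) _.
  by rewrite -exprD NW // -/q; lia.
have B_le (j : 'I_p) : a B`_j <= N ^+ (2 * size bs) * rho.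
  have Nrho0 : 0 <= N * rho by apply: mulr_ge0.
  apply: le_trans (coef_prod_XsubC_le j Nrho0 a_bs) _.
  have j_lt : (j < size bs)%N by apply: leq_trans ds_bs.
  rewrite mulnC muln2 -addnn exprD -mulrA ler_wpM2l // exprMn.
  apply: ler_pM; rewrite ?exprn_ge0 ?NW ?leq_subr //.
  by rewrite -(subnSK j_lt) exprS ler_piMr // exprn_ile1.
have H_le k : a H`_k <= N ^+ (3 * size hs).
  have N20 : 0 <= N ^+ 2 by [].
  apply: le_trans (coef_prod_XsubC_le k N20 a_hs) _.
  by rewrite -exprM -exprD NW //; lia.
have DF_p : (D * F)`_p = \sum_(j < p) D`_j * F`_(p - j) + F`_0.
  by rewrite coefM big_ord_recr /= Dp mul1r subnn.
have DF_le : a (\sum_(j < p) D`_j * F`_(p - j)) <= N ^+ (6 * d) * rho.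
  apply: le_trans (_ : N ^+ p * (N ^+ (p + 2 * q) * rho) <= _).
    apply: qabs_sum_ord => //; first by rewrite mulr_ge0.
    move=> j; rewrite (qabsM qa) exprD mulrAC.
    by apply: ler_pM.
  by rewrite mulrA -exprD ler_wpM2r // NW //; lia.
have BH_le : a (B * H)`_p.-1 <= N ^+ (4 * d) * rho.
  rewrite coefM prednK //.
  apply: le_trans (_ : N ^+ p * (N ^+ (2 * size bs + 3 * size hs) * rho) <= _).
    apply: qabs_sum_ord => //; first by rewrite mulr_ge0.
    move=> j; rewrite (qabsM qa) exprD mulrAC.
    by apply: ler_pM.
  by rewrite mulrA -exprD ler_wpM2r // NW //; lia.
have pDF : p%:R * (D * F)`_p = d%:R * (B * H)`_p.-1.
  have := congr1 (fun P : {poly K} => P`_p.-1) der_eq.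
  by rewrite coef_deriv coefZ prednK // mulr_natl.
have DFp_le : a (D * F)`_p <= N ^+ (6 * d) * rho.
  apply: le_trans (_ : N ^+ d * a p%:R * a (D * F)`_p <= _).
    by rewrite ler_peMl.
  rewrite -mulrA -(qabsM qa) pDF (qabsM qa).
  rewrite (_ : (6 * d = d + (d + 4 * d))%N); last by lia.
  rewrite exprD -mulrA ler_wpM2l // exprD -mulrA.
  by apply: ler_pM => //; apply: qabs_nat.
rewrite -F0 (_ : F`_0 = (D * F)`_p - \sum_(j < p) D`_j * F`_(p - j)); last first.
  by rewrite DF_p addrC addKr.
apply: le_trans (qabsB_le DFp_le DF_le) _.
rewrite mulrA -exprS ler_wpM2r // NW //.
by rewrite ltn_mul2r andbT; lia.
Qed.

End QuasiAbs.

(** * A large critical value *)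

(** There are more consecutive intervals between the levels eta than there are
    distances, so one interval contains no distance. *)
Lemma empty_gap (R : realDomainType) (T : finType) (dist : T -> T -> R)
    (eta : nat -> R) :
  {homo eta : m n / (m <= n)%N >-> n <= m} ->
  exists2 k, (k <= #|T| * #|T|)%N &
    forall i j, dist i j < eta k -> dist i j < eta k.+1.
Proof.
move=> eta_dec; pose n := (#|T| * #|T|).+1.
have [/existsP[k /forallP gap_k]|no_gap] := boolP [exists k : 'I_n,
    [forall x : T * T, (dist x.1 x.2 < eta k) ==> (dist x.1 x.2 < eta k.+1)]].
  exists k => [|i j]; first by rewrite -ltnS ltn_ord.
  by move: (gap_k (i, j)) => /= /implyP.
have /fin_all_exists[g gP] (k : 'I_n) :
    exists x : T * T, eta k.+1 <= dist x.1 x.2 < eta k.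
  move: no_gap; rewrite negb_exists => /forallP/(_ k).
  rewrite negb_forall => /existsP[x]; rewrite negb_imply -leNgt andbC => ?.
  by exists x.
suff /leq_card : injective g by rewrite card_ord card_prod ltnn.
have sep k l : g k = g l -> (k <= l)%N.
  move=> eq_g; rewrite leqNgt; apply/negP => lt_lk.
  have /andP[_ lt_k] := gP k; have /andP[ge_l _] := gP l.
  rewrite eq_g in lt_k; have := lt_le_trans lt_k (eta_dec _ _ lt_lk).
  by rewrite ltNge ge_l.
by move=> k l eq_g; apply/val_inj/anti_leq; rewrite !sep.
Qed.

(** If every class contained fewer points phi c than points of T, summing over
    the classes, of which there are at least two, would give #|C| + 2 <= #|T|. *)
Lemma crowded_class (T C : finType) (near : rel T) (phi : C -> T) i0 j0 :
  equivalence_rel near -> ~~ near i0 j0 -> (#|T| <= #|C|.+1)%N ->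
  exists t, (#|[set x | near t x]| <= #|[set c | near t (phi c)]|)%N.
Proof.
move=> near_eq not_near card_le.
pose rep t := odflt t [pick x | near t x].
have repP t x : (rep t == rep x) = near t x.
  have near_rep y : near y (rep y).
    rewrite /rep; case: pickP => [z //|/(_ y)] /=.
    by rewrite (near_eq y y y).1.
  apply/eqP/idP => [eq_tx|near_tx].
    have [_ near_tr] := near_eq t (rep t) x; rewrite near_tr ?near_rep // eq_tx.
    by rewrite -(near_eq x (rep x) x).2 ?near_rep ?(near_eq x x x).1.
  rewrite /rep (eq_pick (fun y => (near_eq t x y).2 near_tx)).
  by case: pickP => //= /(_ x); rewrite (near_eq x x x).1.
pose im := [set rep t | t : T].
have card_fibers (D : finType) (f : D -> T) :
    #|D| = (\sum_(y in im) #|[set z | rep (f z) == y]|)%N.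
  rewrite -sum1_card (partition_big (rep \o f) (mem im)) => [|z _]; last first.
    exact: imset_f.
  by apply: eq_bigr => y _; rewrite sum1dep_card.
have [/existsP[t le_t]|all_lt] := boolP [exists t,
    (#|[set x | near t x]| <= #|[set c | near t (phi c)]|)%N].
  by exists t.
have fib_lt y : y \in im ->
    (#|[set c | rep (phi c) == y]| < #|[set x | rep x == y]|)%N.
  case/imsetP=> t _ ->{y}.
  move: all_lt; rewrite negb_exists => /forallP/(_ t); rewrite -ltnNge.
  have rep_class (D : finType) (f : D -> T) :
      [set z | rep (f z) == rep t] = [set z | near t (f z)].
    by apply/setP => z; rewrite !inE eq_sym repP.
  by rewrite (rep_class C phi) (rep_class T id).
have card_im : (1 < #|im|)%N.
  rewrite (cardD1 (rep i0)) (cardD1 (rep j0)) !inE !imset_f // andbT.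
  by rewrite eq_sym repP not_near.
have : (\sum_(y in im) (#|[set c | rep (phi c) == y]| + 1) <=
        \sum_(y in im) #|[set x | rep x == y]|)%N.
  by apply: leq_sum => y y_im; rewrite addn1 fib_lt.
rewrite big_split /= -(card_fibers C phi) -(card_fibers T id) sum1_card.
by move=> /leq_trans/(_ card_le); rewrite -addn1 leq_add2l leqNgt card_im.
Qed.

Lemma comp_prod_XsubC_affine (K : fieldType) (I : Type) (s : seq I)
    (r : I -> K) (l t : K) : l != 0 ->
  (\prod_(i <- s) ('X - (r i)%:P)) \Po (l *: 'X + t%:P) =
    l ^+ size s *: \prod_(i <- s) ('X - ((r i - t) / l)%:P).
Proof.
move=> l0; elim: s => [|i s IHs]; first by rewrite !big_nil comp_polyC scale1r.
have lin : ('X - (r i)%:P) \Po (l *: 'X + t%:P) =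
    l *: ('X - ((r i - t) / l)%:P).
  rewrite comp_polyB comp_polyX comp_polyC scalerBr -[l *: _%:P]mul_polyC.
  by rewrite -polyCM [l * _]mulrC divfK // polyCB opprB addrA.
by rewrite !big_cons comp_polyM IHs lin exprS -scalerAl -scalerAr scalerA.
Qed.

Lemma deriv_prod_affine (K : fieldType) (I J : Type) (s : seq I) (s' : seq J)
    (r : I -> K) (c : J -> K) (l t k : K) :
  l != 0 -> size s = (size s').+1 ->
  (\prod_(i <- s) ('X - (r i)%:P))^`() = k *: \prod_(j <- s') ('X - (c j)%:P) ->
  (\prod_(i <- s) ('X - ((r i - t) / l)%:P))^`() =
    k *: \prod_(j <- s') ('X - ((c j - t) / l)%:P).
Proof.
move=> l0 sz_s eq_der; set q := l *: 'X + t%:P.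
have q' : q^`() = l%:P.
  by rewrite derivD derivZ derivX derivC addr0 -mul_polyC mulr1.
move: (deriv_comp (\prod_(i <- s) ('X - (r i)%:P)) q).
rewrite eq_der comp_polyZ !comp_prod_XsubC_affine // q' derivZ sz_s mulrC.
rewrite mul_polyC.
have -> : l *: (k *: (l ^+ size s' *: \prod_(j <- s') ('X - ((c j - t) / l)%:P)))
    = l ^+ (size s').+1 *: (k *: \prod_(j <- s') ('X - ((c j - t) / l)%:P)).
  by rewrite !scalerA exprS; congr (_ *: _); ring.
by apply: scalerI; rewrite expf_neq0.
Qed.

(** The exponents g_k of the distance scales N^(-g_k). They must grow so fast
    that d g_k + 7 d <= g_(k+1), which is what [cluster_bound] requires of two
    consecutive scales. *)
Definition scale_exp (d k : nat) : nat := ((7 * d) ^ k.+1)%N.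

(** Falling below the finest scale for each of the d roots costs d times the
    exponent of that scale. *)
Definition gap_exp (d : nat) : nat := (d * scale_exp d (d * d).+1)%N.

Lemma scale_expS d k : (0 < d)%N ->
  (7 * d + scale_exp d k * d <= scale_exp d k.+1)%N.
Proof.
move=> d_gt0; rewrite /scale_exp [X in (_ <= X)%N]expnS.
have : (7 <= (7 * d) ^ k.+1)%N.
  apply: leq_trans (_ : 7 * d <= _)%N; first by rewrite leq_pmulr.
  by rewrite expnS leq_pmulr // expn_gt0 muln_gt0 d_gt0.
set x := ((7 * d) ^ k.+1)%N => x7.
have : (7 * d <= x * d)%N by rewrite leq_mul.
by rewrite -mulnA [(d * x)%N]mulnC; lia.
Qed.

Lemma scale_exp_mono d : (0 < d)%N -> {homo scale_exp d : k l / (k <= l)%N}.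
Proof. by move=> d_gt0 k l kl; rewrite leq_pexp2l // muln_gt0. Qed.

Lemma expr_size_le_prod (R : realDomainType) (I : eqType) (s : seq I)
    (F : I -> R) (e : R) :
  0 <= e -> (forall i, i \in s -> e <= F i) -> e ^+ size s <= \prod_(i <- s) F i.
Proof.
move=> e0; elim: s => [|i s IHs] F_ge /=; first by rewrite big_nil.
rewrite big_cons exprS ler_pM ?exprn_ge0 // ?F_ge ?mem_head //.
by apply: IHs => j js; apply: F_ge; rewrite inE js orbT.
Qed.

(** Were every critical value small, each critical point would lie near a root.
    At a scale without intermediate distances, being near is an equivalence
    relation on the roots, with at least two classes because the roots sum to 0
    and are not all 0. As there are d roots and d - 1 critical points, some
    class of m roots has at least m critical points near it, whereas only m - 1
    zeros of the derivative can be close to a cluster of m roots: this is what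
    [cluster_bound] expresses. *)
Lemma normalized_critical_value (R : realFieldType) (K : fieldType) (N : R)
    (a : K -> R) (T C : finType) (r : T -> K) (c : C -> K) (d : nat) t0 :
  quasi_abs N a ->
  (forall m, (0 < m <= d)%N -> 1 <= N ^+ d * a m%:R) ->
  d = #|T| -> d = #|C|.+1 -> (1 < d)%N ->
  \sum_t r t = 0 -> a (r t0) = 1 -> (forall t, a (r t) <= 1) ->
  (\prod_t ('X - (r t)%:P))^`() = d%:R *: \prod_j ('X - (c j)%:P) ->
  exists j, 1 <= N ^+ gap_exp d * \prod_t a (c j - r t).
Proof.
move=> qa a_nat cardT cardC d_gt1 sum_r a_t0 a_r der_eq.
have N1 := qabs_ge1 qa; have a_ge0 := qabs_ge0 qa.
have N_gt0 : 0 < N by apply: lt_le_trans N1.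
have N0 := ltW N_gt0.
have d_gt0 : (0 < d)%N by apply: ltnW.
have NW i j : (i <= j)%N -> N ^+ i <= N ^+ j by move=> ij; apply: ler_weXn2l.
pose eta k : R := N ^- scale_exp d k.
have eta_gt0 k : 0 < eta k by rewrite invr_gt0 exprn_gt0.
have eta_dec : {homo eta : m n / (m <= n)%N >-> n <= m}.
  move=> m n mn; rewrite /eta lef_pV2 ?posrE ?exprn_gt0 //.
  by rewrite NW // scale_exp_mono.
have eta_le1 k : eta k <= 1 by rewrite invf_le1 ?exprn_gt0 // exprn_ege1.
have N_eta k : N * eta k.+1 <= eta k.
  rewrite /eta ler_pdivrMr ?exprn_gt0 // ler_pdivlMl ?exprn_gt0 //.
  rewrite -exprSr NW //; apply: leq_trans (scale_expS k d_gt0).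
  by rewrite -[(scale_exp d k).+1]add1n leq_add ?leq_pmulr //; lia.
pose dist i j := a (r i - r j).
have dist_sym i j : dist i j = dist j i by apply: (qabs_subC qa).
have dist_tri i j k : dist i k <= N * Num.max (dist i j) (dist j k).
  by apply: le_trans (qabsD qa _ _); rewrite addrA subrK.
have [k k_le gap_k] := empty_gap dist eta_dec.
(* Nothing lies between eta k.+1 and eta k, so near is transitive although
   the triangle inequality loses a factor N. *)
pose near i j := dist i j < eta k.+1.
have near_trans i j l : near i j -> near j l -> near i l.
  move=> ij jl; apply: gap_k; apply: le_lt_trans (dist_tri i j l) _.
  by apply: lt_le_trans (N_eta k); rewrite ltr_pM2l // gt_max; apply/andP.
have near_refl i : near i i by rewrite /near /dist subrr (qabs0 qa).
have near_sym i j : near i j = near j i by rewrite /near dist_sym.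
have near_equiv : equivalence_rel near.
  move=> i j l; split=> // ij; apply/idP/idP; last exact: near_trans.
  by apply: near_trans; rewrite near_sym.
(* Since the roots sum to 0, d times a root of absolute value 1 is the sum of
   its differences with the roots, which cannot all be below N^(-2 d). *)
have [i0 far_i0] : exists i0, ~~ near t0 i0.
  pose i0 := [arg max_(i > t0) dist t0 i]%O; exists i0.
  have i0_max i : dist t0 i <= dist t0 i0.
    by rewrite /i0; case: (arg_maxP (dist t0)) => // i1 _; apply.
  rewrite /near -leNgt; apply: le_trans (eta_dec 0%N _ isT) _.
  rewrite /eta -[leLHS]mulr1 ler_pdivrMl ?exprn_gt0 //.
  have sum_dist : d%:R * r t0 = \sum_t (r t0 - r t).
    by rewrite sumrB sum_r subr0 sumr_const mulr_natl -cardT.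
  have : 1 <= N ^+ d * (N ^+ d * dist t0 i0).
    have d_le : 1 <= N ^+ d * a d%:R by apply: a_nat; rewrite d_gt0 leqnn.
    apply: le_trans d_le _; rewrite ler_pM2l ?exprn_gt0 //.
    rewrite -[leLHS]mulr1 -a_t0 -(qabsM qa) sum_dist cardT cardE -big_enum.
    by apply: (qabs_sum qa) => [|i _]; [exact: a_ge0|exact: i0_max].
  move=> /le_trans; apply; rewrite mulrA -exprD ler_wpM2r ?a_ge0 // NW //.
  by rewrite /scale_exp expn1; lia.
apply: contrapT => no_crit.
have /fin_all_exists[phi phiP] j : exists i, a (c j - r i) < eta (d * d).+1.
  apply: contrapT => far_j; apply: no_crit; exists j.
  rewrite -ler_pdivrMl ?exprn_gt0 // mulr1 /gap_exp mulnC exprM -exprVn.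
  rewrite [X in _ ^+ X]cardT -prodr_const.
  apply: ler_prod => i _; apply/andP; split.
    by rewrite invr_ge0 exprn_ge0.
  by rewrite leNgt; apply/negP => lt_i; apply: far_j; exists i.
have [t crowd_t] : exists t,
    (#|[set x | near t x]| <= #|[set j | near t (phi j)]|)%N.
  by apply: (crowded_class phi near_equiv far_i0); rewrite -cardT cardC.
(* rho is attained, hence strictly below eta k.+1; this strictness gives the
   contradiction when N = 1, where all scales coincide. *)
pose rho : R := Num.max (\big[Num.max/0]_(i | near t i) dist i t)
  (\big[Num.max/0]_j a (c j - r (phi j))).
have rho0 : 0 <= rho by rewrite le_max bigmax_ge_id.
have rho_lt : rho < eta k.+1.
  rewrite gt_max !bigmax_lt //= => [j _|i ti]; last by rewrite dist_sym.
  by apply: lt_le_trans (phiP j) _; apply: eta_dec; rewrite ltnS cardT.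
have rho_near i : near t i -> dist i t <= rho.
  by move=> ti; rewrite le_max (le_bigmax_cond _ (fun i => dist i t)).
have rho_crit j : a (c j - r (phi j)) <= rho.
  by rewrite le_max (le_bigmax _ (fun j => a (c j - r (phi j)))) orbT.
have dist_le i j : dist i j <= N by rewrite -[N]mulr1; apply: (qabsB_le qa).
(* The crowded class, its near critical points and their complements, all
   translated so that the root r t of the class is at the origin. *)
pose Bl := [set x | near t x]; pose Cl := [set j | near t (phi j)].
pose ds := [seq r i - r t | i <- enum Bl].
pose fs := [seq r i - r t | i <- enum (~: Bl)].
pose bs := [seq c j - r t | j <- enum Cl].
pose hs := [seq c j - r t | j <- enum (~: Cl)].
have split_prod (D : finType) (A : {set D}) (V : comNzRingType) (F : D -> V) :
    \prod_i F i = \prod_(i <- enum A) F i * \prod_(i <- enum (~: A)) F i.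
  rewrite !big_enum (bigID (mem A)) /=; congr (_ * _).
  by apply: eq_bigl => i; rewrite inE.
have sz_d : d = (size ds + size fs)%N.
  by rewrite !size_map -!cardE cardsC.
have sz_c : (size bs + size hs).+1 = d.
  by rewrite !size_map -!cardE cardsC.
have Bl_t : t \in Bl by rewrite inE.
have ds_gt0 : (0 < size ds)%N by rewrite size_map -cardE (cardD1 t) Bl_t.
have ds_lt : (size ds < d)%N.
  rewrite size_map -cardE cardT -cardsT; apply: proper_card.
  rewrite properT; apply/eqP => BlT; case/negP: far_i0.
  have : i0 \in Bl /\ t0 \in Bl by rewrite BlT !inE.
  by rewrite !inE => -[ti0 tt0]; apply: near_trans ti0; rewrite near_sym.
have bound : \prod_(x <- fs) a x <= N ^+ (7 * d) * rho.
  apply: (@cluster_bound _ _ _ _ qa ds fs bs hs rho d sz_d) => //.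
  - by rewrite rho0 (ltW (lt_le_trans rho_lt (eta_le1 _))).
  - by move=> x /mapP[i + ->]; rewrite mem_enum inE => ti; apply: rho_near.
  - by move=> x /mapP[i _ ->]; apply: dist_le.
  - move=> x /mapP[j + ->]; rewrite mem_enum inE => tj.
    rewrite -(subrKA (r (phi j))).
    by apply: (qabsD_le qa); [apply: rho_crit|apply: rho_near].
  - move=> x /mapP[j _ ->]; rewrite -(subrKA (r (phi j))).
    apply: (qabsD_le qa); last exact: dist_le.
    apply: le_trans (rho_crit j) _; apply: le_trans N1.
    exact: le_trans (ltW rho_lt) (eta_le1 _).
  - by rewrite !size_map -!cardE.
  - by apply: a_nat; rewrite ds_gt0 ltnW.
  - have := @deriv_prod_affine _ _ _ (index_enum T) (index_enum C) r c 1 (r t) d%:R.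
    rewrite oner_eq0 -(sum1_size (index_enum T)) -(sum1_size (index_enum C)).
    rewrite !sum1_card -cardT -cardC => /(_ isT erefl der_eq).
    under eq_bigr do rewrite divr1; under [X in _ = _ *: X]eq_bigr do rewrite divr1.
    by rewrite !big_map -(split_prod _ Bl) -(split_prod _ Cl).
suff: N ^+ (7 * d) * rho < \prod_(x <- fs) a x by rewrite ltNge bound.
apply: lt_le_trans (_ : N ^+ (7 * d) * eta k.+1 <= _).
  by rewrite ltr_pM2l ?exprn_gt0.
apply: le_trans (_ : eta k ^+ size fs <= _).
  apply: le_trans (_ : eta k ^+ d <= _); last first.
    by rewrite ler_wiXn2l // ?ltW // sz_d leq_addl.
  rewrite /eta exprVn -exprM ler_pdivrMr ?exprn_gt0 // ler_pdivlMl ?exprn_gt0 //.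
  by rewrite -exprD NW // addnC scale_expS.
apply: expr_size_le_prod => [|x /mapP[i + ->]]; first exact: ltW.
rewrite mem_enum !inE leNgt; apply: contra => dist_lt.
by apply: gap_k; rewrite dist_sym.
Qed.

(** The normalised case applies after dividing by a root of largest absolute
    value. *)
Lemma critical_value (R : realFieldType) (K : fieldType) (N : R) (a : K -> R)
    (rs cs : seq K) (d : nat) :
  quasi_abs N a ->
  (forall m, (0 < m <= d)%N -> 1 <= N ^+ d * a m%:R) ->
  d = size rs -> d = (size cs).+1 -> (1 < d)%N ->
  \sum_(r <- rs) r = 0 ->
  (\prod_(r <- rs) ('X - r%:P))^`() = d%:R *: \prod_(c <- cs) ('X - c%:P) ->
  exists2 c, c \in cs &
    forall r, r \in rs -> a r ^+ d <= N ^+ gap_exp d * a (\prod_(r <- rs) ('X - r%:P)).[c].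
Proof.
move=> qa a_nat sz_rs sz_cs d_gt1 sum_rs der_eq.
have a_ge0 := qabs_ge0 qa.
have N0 : 0 <= N by apply: le_trans (qabs_ge1 qa).
pose T := 'I_(size rs); pose C := 'I_(size cs).
pose r (i : T) := tnth (in_tuple rs) i; pose c (j : C) := tnth (in_tuple cs) j.
have r_mem x : x \in rs -> exists i, x = r i.
  by move=> xs; have /tnthP[i ->] : x \in in_tuple rs by []; exists i.
have t_ex : (0 < size rs)%N by rewrite -sz_rs ltnW.
have j_ex : (0 < size cs)%N by rewrite -ltnS -sz_cs.
pose t0 : T := [arg max_(i > Ordinal t_ex) a (r i)]%O.
have t0_max i : a (r i) <= a (r t0).
  by rewrite /t0; case: (arg_maxP (fun i => a (r i))) => // i1 _; apply.
have c_mem j : c j \in cs by apply: mem_tnth.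
have [r0|r_neq0] := eqVneq (r t0) 0.
  exists (c (Ordinal j_ex)) => // x /r_mem[i ->].
  apply: le_trans (_ : 0 <= _); last by rewrite mulr_ge0 ?exprn_ge0.
  have := t0_max i; rewrite r0 (qabs0 qa) => a_le0.
  have /eqP -> : a (r i) == 0 by rewrite eq_le a_le0 a_ge0.
  by rewrite expr0n eqn0Ngt ltnW.
have a_gt0 : 0 < a (r t0) by rewrite lt_def a_ge0 (qabs_neq0 qa).
have prod_tnth (s : seq K) (V : comNzRingType) (F : K -> V) :
    \prod_(x <- s) F x = \prod_(i < size s) F (tnth (in_tuple s) i).
  by rewrite big_tnth.
have [||||||j] := @normalized_critical_value _ _ _ _ T C
  (fun i => r i / r t0) (fun j => c j / r t0) d t0 qa a_nat _ _ d_gt1.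
- by rewrite card_ord.
- by rewrite card_ord.
- by rewrite -mulr_suml -[X in X / _](big_tnth _ _ rs xpredT id) sum_rs mul0r.
- by rewrite mulfV // (qabs1 qa).
- move=> i; rewrite (qabsM qa) (qabsV qa) ler_pdivrMr // mul1r.
  exact: t0_max.
- have sz_enum : size (index_enum T) = (size (index_enum C)).+1.
    rewrite -(sum1_size (index_enum T)) -(sum1_size (index_enum C)).
    by rewrite !sum1_card !card_ord -sz_rs.
  have := @deriv_prod_affine _ _ _ _ _ r c (r t0) 0 d%:R r_neq0 sz_enum.
  rewrite -[X in X^`() = _ -> _](prod_tnth rs _ (fun x => 'X - x%:P)).
  rewrite -[X in _ = _ *: X -> _](prod_tnth cs _ (fun x => 'X - x%:P)).
  move=> /(_ der_eq).
  by under eq_bigr do rewrite subr0; under [in RHS]eq_bigr do rewrite subr0.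
move=> le1; exists (c j) => // x /r_mem[i ->].
apply: le_trans (_ : a (r t0) ^+ d <= _).
  by apply: lerXn2r; rewrite ?nnegrE ?a_ge0.
rewrite horner_prod (qabs_prod qa) prod_tnth.
under eq_bigr do rewrite hornerXsubC.
move: le1; under eq_bigr do rewrite -mulrBl (qabsM qa) (qabsV qa).
rewrite big_split /= prodr_const card_ord -[X in _^-1 ^+ X]sz_rs exprVn mulrA.
by rewrite ler_pdivlMr ?exprn_gt0 // mul1r.
Qed.

(** * Local bounds for heights *)

Definition max1 (R : realFieldType) (K : Type) (a : K -> R) (xs : seq K) : R :=
  \big[Num.max/1]_(x <- xs) a x.

Section Max1.

Variables (R : realFieldType) (K : eqType) (a : K -> R).

Lemma max1_ge1 xs : 1 <= max1 a xs.
Proof. by rewrite /max1; elim/big_rec: _ => // x m _ m1; rewrite le_max m1 orbT. Qed.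

Lemma max1_ge0 xs : 0 <= max1 a xs.
Proof. exact: le_trans ler01 (max1_ge1 xs). Qed.

Lemma max1_gt0 xs : 0 < max1 a xs.
Proof. exact: lt_le_trans ltr01 (max1_ge1 xs). Qed.

Lemma max1_ge xs x : x \in xs -> a x <= max1 a xs.
Proof.
rewrite /max1; elim: xs => // y xs IHxs; rewrite inE big_cons le_max.
by case/predU1P=> [->|/IHxs ->]; rewrite ?lexx ?orbT.
Qed.

Lemma max1_le xs M : 1 <= M -> (forall x, x \in xs -> a x <= M) -> max1 a xs <= M.
Proof.
move=> M1 xsM; rewrite /max1 big_seq_cond; elim/big_ind: _ => //.
  by move=> x y xM yM; rewrite ge_max xM.
by move=> x /andP[/xsM].
Qed.

Lemma max1_seq1 x : max1 a [:: x] = Num.max (a x) 1.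
Proof. by rewrite /max1 big_cons big_nil. Qed.

Lemma max1_sub xs ys : {subset xs <= ys} -> max1 a xs <= max1 a ys.
Proof.
by move=> sub; apply: max1_le (max1_ge1 ys) _ => x /sub/max1_ge.
Qed.

End Max1.

Section MaxOne.

Variables (R : realFieldType) (K : fieldType) (N : R) (a : K -> R).
Hypothesis qa : quasi_abs N a.

Let N1 : 1 <= N := qabs_ge1 qa.
Let a_ge0 x : 0 <= a x := qabs_ge0 qa x.

Let N0 : 0 <= N. Proof. exact: le_trans ler01 N1. Qed.
Let NX1 n : 1 <= N ^+ n. Proof. exact: exprn_ege1. Qed.
Let NX0 n : 0 <= N ^+ n. Proof. exact: exprn_ge0. Qed.

Lemma max1_horner (f : {poly K}) z d : (size f <= d.+1)%N ->
  max1 a [:: f.[z]] <= N ^+ d.+1 * (max1 a f * max1 a [:: z] ^+ d).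
Proof.
move=> sz_f; set M := _ * _ ^+ d.
have M1 : 1 <= M.
  by rewrite -[1]mulr1 ler_pM ?max1_ge1 // exprn_ege1 ?max1_ge1.
apply: max1_le => [|x]; first by rewrite -[1]mulr1 ler_pM.
rewrite inE => /eqP ->; rewrite (horner_coef_wide z sz_f).
apply: (qabs_sum_ord qa) => [|i]; first exact: le_trans ler01 M1.
rewrite (qabsM qa) (qabsX qa) ler_pM ?exprn_ge0 //.
  have [i_lt|i_ge] := ltnP i (size f); first by rewrite max1_ge // mem_nth.
  by rewrite nth_default // (qabs0 qa) max1_ge0.
apply: le_trans (_ : max1 a [:: z] ^+ i <= _).
  by rewrite lerXn2r ?nnegrE ?max1_ge0 // max1_ge ?mem_head.
by rewrite ler_weXn2l ?max1_ge1 // -ltnS.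
Qed.

Lemma max1_coef_le_roots (rs : seq K) :
  max1 a (\prod_(r <- rs) ('X - r%:P)) <= N ^+ size rs * max1 a rs ^+ size rs.
Proof.
apply: max1_le => [|x /(nthP 0)[k _ <-]].
  by rewrite -[1]mulr1 ler_pM // exprn_ege1 // max1_ge1.
apply: le_trans (coef_prod_XsubC_le qa k (max1_ge0 a rs) (@max1_ge _ _ a rs)) _.
by rewrite ler_wpM2l // ler_weXn2l ?max1_ge1 ?leq_subr.
Qed.

(** The inequality of Mahler and Gelfond, by dividing out one root at a time:
    the coefficients of P / (z - c) are found from the top when |c| <= 1 and
    from the bottom when |c| > 1, and in the latter case each carries a factor
    1 / |c|. *)
Lemma prod_max1_roots_le (cs : seq K) (M : R) :
  (forall k, a (\prod_(c <- cs) ('X - c%:P))`_k <= M) ->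
  \prod_(c <- cs) max1 a [:: c] <= N ^+ (size cs * size cs) * M.
Proof.
elim: cs M => [|c cs IHcs] M.
  by move=> /(_ 0%N); rewrite !big_nil coef1 (qabs1 qa) expr0 mul1r.
rewrite !big_cons /=; set Q := \prod_(_ <- _) ('X - _); set n := size cs => PM.
have M0 : 0 <= M by apply: le_trans (PM 0%N).
have P0 : (('X - c%:P) * Q)`_0 = - (c * Q`_0).
  by rewrite mulrBl coefB coefXM coefCM sub0r.
have PS k : (('X - c%:P) * Q)`_k.+1 = Q`_k - c * Q`_k.+1.
  by rewrite mulrBl coefB coefXM coefCM.
have szQ : size Q = n.+1 by rewrite size_prod_XsubC.
have leM k : M <= N ^+ k * M by rewrite ler_peMl.
have QM k : max1 a [:: c] * a Q`_k <= N ^+ n * M.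
  have [k_ge|k_lt] := ltnP n k.
    by rewrite nth_default ?szQ // (qabs0 qa) mulr0 mulr_ge0.
  have NnM j : (j <= n)%N -> N ^+ j * M <= N ^+ n * M.
    by move=> jn; rewrite ler_wpM2r // ler_weXn2l.
  rewrite max1_seq1; have [c_le1|c_gt1] := leP (a c) 1.
    rewrite mul1r; apply: le_trans (NnM _ (leq_subr k n)).
    rewrite -[in a Q`_k](subKn k_lt); move: (n - k)%N (leq_subr k n).
    elim=> [_|j IHj j_lt].
      rewrite subn0 mul1r; have := PM n.+1; rewrite PS [Q`_n.+1]nth_default ?szQ //.
      by rewrite mulr0 subr0.
    have := PM (n - j)%N; rewrite -subnSK // PS => Pj.
    rewrite (_ : Q`_(n - j.+1) =
      (Q`_(n - j.+1) - c * Q`_(n - j.+1).+1) + c * Q`_(n - j.+1).+1); last first.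
      by rewrite subrK.
    rewrite exprS -mulrA; apply: (qabsD_le qa); first exact: le_trans (leM j).
    rewrite (qabsM qa) subnSK //; apply: le_trans (IHj (ltnW j_lt)).
    by rewrite ler_piMl.
  apply: le_trans (NnM _ k_lt).
  elim: {k_lt} k => [|k IHk].
    by rewrite expr0 mul1r -(qabsM qa) -(qabsN qa) -P0.
  rewrite -(qabsM qa) (_ : c * _ = Q`_k - (Q`_k - c * Q`_k.+1)); last first.
    by rewrite opprB addrC subrK.
  rewrite exprS -mulrA; apply: (qabsB_le qa); last by rewrite -PS; apply: le_trans (leM k).
  by apply: le_trans IHk; rewrite ler_peMl // ltW.
have c_gt0 := max1_gt0 a [:: c].
have {}IHcs := IHcs (N ^+ n * M / max1 a [:: c]).
apply: le_trans (_ : N ^+ (n * n) * (N ^+ n * M) <= _).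
  rewrite mulrC -ler_pdivlMr // -mulrA; apply: IHcs => k.
  by rewrite ler_pdivlMr // mulrC.
by rewrite mulrA -exprD ler_wpM2r // ler_weXn2l //; lia.
Qed.

Lemma prod_max1_critical_le (f : {poly K}) (cs : seq K) (d : nat) :
  (forall m, (0 < m <= d)%N -> 1 <= N ^+ d * a m%:R) ->
  d = (size cs).+1 -> (size f <= d.+1)%N ->
  f^`() = d%:R *: \prod_(c <- cs) ('X - c%:P) ->
  \prod_(c <- cs) max1 a [:: c] <= N ^+ (d * d + 2 * d) * max1 a f.
Proof.
move=> a_nat sz_cs sz_f der_eq.
have d_gt0 : (0 < d)%N by rewrite sz_cs.
have ad : 1 <= N ^+ d * a d%:R by apply: a_nat; rewrite d_gt0 leqnn.
have mf0 : 0 <= max1 a f by apply: max1_ge0.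
apply: le_trans (@prod_max1_roots_le cs (N ^+ (2 * d) * max1 a f) _) _; last first.
  by rewrite mulrA -exprD ler_wpM2r // ler_weXn2l //; lia.
move=> k; set P := \prod_(c <- cs) _ in der_eq *.
have [k_lt|k_ge] := ltnP k d; last first.
  rewrite nth_default ?(qabs0 qa) ?mulr_ge0 // size_prod_XsubC.
  by rewrite -sz_cs.
have Pk : d%:R * P`_k = f`_k.+1 * k.+1%:R.
  by rewrite -coefZ -der_eq coef_deriv mulr_natr.
apply: le_trans (_ : N ^+ d * a d%:R * a P`_k <= _); first by rewrite ler_peMl.
rewrite -mulrA -(qabsM qa) Pk (qabsM qa) mul2n -addnn exprD -mulrA ler_wpM2l //.
rewrite mulrC ler_pM //.
  by apply: le_trans (qabs_nat qa _) _; rewrite ler_weXn2l.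
have [kf|kf] := ltnP k.+1 (size f); first by rewrite max1_ge // mem_nth.
by rewrite nth_default // (qabs0 qa).
Qed.

End MaxOne.

(** Beyond N times the radius of the roots, |z - r| >= |z| / N for every root;
    dividing by N^2 absorbs the constant, since d + 2 <= 2 d. *)
Lemma escape_step (R : realFieldType) (K : fieldType) (N : R) (a : K -> R)
    (rs : seq K) (M : R) (z : K) :
  quasi_abs N a -> (1 < size rs)%N -> (forall r, r \in rs -> a r <= M) ->
  N * M < a z ->
  N ^+ 2 * (a z / N ^+ 2) ^+ size rs <= a (\prod_(r <- rs) ('X - r%:P)).[z].
Proof.
move=> qa sz_rs rsM zM.
have N1 := qabs_ge1 qa; have a_ge0 := qabs_ge0 qa.
have N_gt0 : 0 < N by apply: lt_le_trans N1.
have N2_gt0 : 0 < N ^+ 2 by rewrite exprn_gt0.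
apply: le_trans (_ : (a z / N) ^+ size rs <= _).
  rewrite !exprMn !exprVn mulrCA ler_wpM2l ?exprn_ge0 //.
  rewrite ler_pdivrMr ?exprn_gt0 // -exprM mulrC ler_pdivlMr ?exprn_gt0 //.
  by rewrite -exprD ler_weXn2l //; lia.
rewrite horner_prod (qabs_prod qa).
apply: expr_size_le_prod => [|r r_rs]; first by rewrite divr_ge0 ?a_ge0 ?ltW.
rewrite hornerXsubC ler_pdivrMr // mulrC.
have := qabsD qa (z - r) r; rewrite subrK.
case: (leP (a (z - r)) (a r)) => // _ zr.
have := le_trans zr (ler_pM (ltW N_gt0) (a_ge0 _) (lexx N) (rsM r r_rs)).
by rewrite leNgt zM.
Qed.

(** The critical point of [critical_value] has a value so large that its orbit
    escapes at once, and then |f^k(c)| grows like |f(c)|^(d^(k-1)) with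
    |f(c)| at least about the d-th power of the largest root. If that root is
    not large enough for this, the left-hand side is nonpositive. *)
Lemma critical_escape (R : realType) (K : fieldType) (N : R) (a : K -> R)
    (rs cs : seq K) (d : nat) (f := \prod_(r <- rs) ('X - r%:P)) :
  quasi_abs N a ->
  (forall m, (0 < m <= d)%N -> 1 <= N ^+ d * a m%:R) ->
  d = size rs -> d = (size cs).+1 -> (1 < d)%N ->
  \sum_(r <- rs) r = 0 ->
  f^`() = d%:R *: \prod_(c <- cs) ('X - c%:P) ->
  exists2 c, c \in cs & forall k,
    ln (max1 a rs) - (gap_exp d + 3)%:R * ln N <=
      d%:R ^- k.+1 * ln (max1 a [:: iter k.+1 (fun w => f.[w]) c]).
Proof.
move=> qa a_nat sz_rs sz_cs d_gt1 sum_rs der_eq.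
have N1 := qabs_ge1 qa; have a_ge0 := qabs_ge0 qa.
have N_gt0 : 0 < N by apply: lt_le_trans N1.
have lnN0 : 0 <= ln N by rewrite ln_ge0.
have [c c_cs c_val] := critical_value qa a_nat sz_rs sz_cs d_gt1 sum_rs der_eq.
exists c => // k; move: (gap_exp d) c_val => g c_val; set M := max1 a rs.
have M_gt0 : 0 < M by apply: max1_gt0.
have dX_gt0 n : 0 < d%:R ^- n :> R by rewrite invr_gt0 exprn_gt0 // ltr0n ltnW.
have rhs0 z : 0 <= d%:R ^- k.+1 * ln (max1 a [:: z]).
  by rewrite mulr_ge0 ?(ltW (dX_gt0 _)) // ln_ge0 // max1_ge1.
have [M_le|M_gt] := leP M (N ^+ (g + 3)).
  apply: le_trans (rhs0 _); rewrite subr_le0 mulr_natl -lnXn //.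
  by rewrite ler_ln ?posrE ?exprn_gt0.
have M1 : 1 < M by apply: le_lt_trans M_gt; rewrite exprn_ege1.
have [r r_rs Mr] : exists2 r, r \in rs & M = a r.
  have : 1 < M by []; rewrite /M /max1.
  elim: (rs) => [|x s IHs]; first by rewrite big_nil ltxx.
  rewrite big_cons; set m := \big[_/_]_(_ <- s) _ in IHs *.
  case: (leP (a x) m) => [_ M1'|_ _].
    by have [r rs' ->] := IHs M1'; exists r => //; rewrite inE rs' orbT.
  by exists x; rewrite ?mem_head.
(* y bounds |f(c)| / N^2 from below, the variable in which one step of the
   orbit is at least the d-th power. *)
pose y := M ^+ d / N ^+ (g + 2).
have y_gt : M < N * y.
  rewrite /y mulrA ltr_pdivlMr ?exprn_gt0 // mulrC.
  apply: le_lt_trans (_ : N ^+ (g + 3) * M < _).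
    by rewrite ler_wpM2r ?(ltW M_gt0) // ler_weXn2l // leq_add2l.
  apply: lt_le_trans (_ : M * M <= _); first by rewrite ltr_pM2r.
  apply: le_trans (_ : M ^+ d <= _); last by rewrite ler_peMl // exprn_ge0 // ltW.
  by rewrite -expr2 ler_weXn2l // ltW.
have y1 : 1 <= y.
  rewrite /y ler_pdivlMr ?exprn_gt0 // mul1r.
  apply: le_trans (_ : N ^+ (g + 3) <= _).
    by rewrite ler_weXn2l // leq_add2l.
  apply: le_trans (ltW M_gt) _; rewrite -[leLHS]expr1.
  by rewrite ler_weXn2l ?(ltW M1) // ltnW.
have y_gt0 : 0 < y by apply: lt_le_trans y1.
have N2_gt0 : 0 < N ^+ 2 by rewrite exprn_gt0.
have orbit_ge n : N ^+ 2 * y ^+ (d ^ n) <= a (iter n.+1 (fun w => f.[w]) c).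
  elim: n => [|n IHn].
    have -> : N ^+ 2 * y ^+ (d ^ 0) = M ^+ d / N ^+ g.
      by rewrite expn0 expr1 /y exprD invfM mulrC -mulrA divfK ?gt_eqF.
    by rewrite ler_pdivrMr ?exprn_gt0 // mulrC Mr c_val.
  set z := iter n.+1 _ c in IHn *.
  have zM : N * M < a z.
    apply: lt_le_trans IHn; rewrite expr2 -mulrA ltr_pM2l //.
    apply: lt_le_trans y_gt _; rewrite ler_pM2l // -[leLHS]expr1.
    by rewrite ler_weXn2l // expn_gt0 ltnW.
  have := @escape_step _ _ _ _ rs M z qa _ (@max1_ge _ _ a rs) zM.
  rewrite -sz_rs => /(_ d_gt1); apply: le_trans.
  rewrite ler_pM2l // expnSr exprM lerXn2r ?nnegrE ?divr_ge0 ?exprn_ge0 ?(ltW y_gt0) ?(ltW N_gt0) //.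
  by rewrite ler_pdivlMr // mulrC.
have {}orbit_ge : y ^+ (d ^ k) <= max1 a [:: iter k.+1 (fun w => f.[w]) c].
  apply: le_trans (max1_ge a (mem_head _ _)); apply: le_trans (orbit_ge k).
  by rewrite ler_peMl ?exprn_ge0 ?(ltW y_gt0) // exprn_ege1.
apply: le_trans (_ : d%:R ^- k.+1 * ln (y ^+ (d ^ k)) <= _); last first.
  by rewrite ler_pM2l // ler_ln ?posrE ?exprn_gt0 ?max1_gt0.
have d_gt0 : 0 < d%:R :> R by rewrite ltr0n ltnW.
rewrite lnXn // -[ln y *+ _]mulr_natl natrX exprS invfM -mulrA mulKf ?expf_neq0 ?gt_eqF //.
rewrite /y lnM ?posrE ?invr_gt0 ?exprn_gt0 // lnV ?posrE ?exprn_gt0 // !lnXn //.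
rewrite mulrDr -[ln M *+ d]mulr_natl mulKf ?gt_eqF // lerD2l.
rewrite mulrN lerN2 -[ln N *+ _]mulr_natl.
apply: le_trans (_ : (g + 2)%:R * ln N <= _); last first.
  by rewrite ler_wpM2r // ler_nat leq_add2l.
by rewrite ler_piMl ?mulr_ge0 // invf_le1 // ler1n ltnW.
Qed.

(** * Places *)

(** For large B a given algebraic number is integral outside this set; the
    positive integers up to B are units outside it for every B. *)
Definition places_upto (B : nat) : seq place :=
  None :: [seq Some p | p <- pmap insub (iota 0 B.+1)].

Lemma places_upto_uniq B : uniq (places_upto B).
Proof.
have Some_inj : injective (@Some {p : nat | prime p}) by move=> p q [].
rewrite /places_upto cons_uniq map_inj_uniq // pmap_sub_uniq ?iota_uniq // andbT.
by apply/mapP => -[].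
Qed.

Lemma size_places_upto B : (size (places_upto B) <= B.+2)%N.
Proof.
rewrite /places_upto -[X in (_ <= X.+1)%N](size_iota 0); move: (iota _ _) => s.
by rewrite /= size_map size_pmap ltnS count_size.
Qed.

Lemma mem_places_upto B v :
  v \in places_upto B = if v is Some p then (val p <= B)%N else true.
Proof.
have Some_inj : injective (@Some {p : nat | prime p}) by move=> p q [].
case: v => [p|]; last by rewrite mem_head.
rewrite /places_upto in_cons (mem_map Some_inj) orFb.
by rewrite mem_pmap_sub mem_iota /= add0n ltnS.
Qed.

(** Only for p > d are the integers 1, ..., d units at p, as the proof that
    loses nothing requires; elsewhere the factor 2 of the triangle inequality
    is affordable, because there are few such places. *)
Definition defect (R : realFieldType) (d : nat) (v : place) : R :=
  if v \in places_upto d then 2 else 1.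

(** Otherwise t = 1 + e with e > 0, and Bernoulli's inequality applied to
    t^(2n) = (t^n)^2 gives quadratic growth. *)
Lemma expr_le_linear (R : realType) (t : R) :
  (forall n, t ^+ n <= n.+1%:R) -> t <= 1.
Proof.
move=> tX; rewrite leNgt; apply/negP => t_gt1; pose e := t - 1.
have e_gt0 : 0 < e by rewrite subr_gt0.
have bern n : 1 + n%:R * e <= t ^+ n.
  elim: n => [|n IHn]; first by rewrite mul0r addr0.
  rewrite exprS; apply: le_trans (_ : t * (1 + n%:R * e) <= _).
    rewrite -[t](subrK 1) -/e -natr1.
    have : 0 <= n%:R * e * e by rewrite !mulr_ge0 // ltW.
    nra.
  by rewrite ler_pM2l // (lt_trans ltr01).
have n_e2 n : n%:R * e ^+ 2 <= 2.
  case: n => [|n]; first by rewrite mul0r.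
  have n0 : 0 < n.+1%:R :> R by rewrite ltr0n.
  have sq : (1 + n.+1%:R * e) ^+ 2 <= (2 * n.+1).+1%:R.
    apply: le_trans (tX (2 * n.+1)%N); rewrite mulnC exprM.
    rewrite lerXn2r ?nnegrE ?bern ?addr_ge0 ?mulr_ge0 ?exprn_ge0 ?(ltW e_gt0) //.
    by rewrite ltW // (lt_trans ltr01).
  rewrite -[(2 * _).+1%:R]natr1 natrM in sq.
  by rewrite -(ler_pM2l n0); nra.
have e2_gt0 : 0 < e ^+ 2 by rewrite exprn_gt0.
have := n_e2 (Num.truncn (2 / e ^+ 2)).+1.
by rewrite -ler_pdivlMr // leNgt truncnS_gt.
Qed.

Section AbsExtension.

Variables (R : realType) (v : place) (a : algC -> R).
Hypothesis av : abs_extension v a.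

Lemma quasi_abs2 : quasi_abs 2 a.
Proof.
case: av => a_ge0 a_eq0 aM aD _; split=> // [|x y]; first by rewrite ler1n.
apply: le_trans (aD x y) _; rewrite mulrDl mul1r.
by rewrite lerD // le_max lexx ?orbT.
Qed.

Lemma abs_ext_nat n : a n%:R = abs_rat R v n%:R.
Proof. by rewrite -(abs_ext_rat av) ratr_nat. Qed.

Lemma abs_ext_sum (I : Type) (s : seq I) F :
  a (\sum_(i <- s) F i) <= \sum_(i <- s) a (F i).
Proof.
elim: s => [|i s IHs]; first by rewrite !big_nil (qabs0 quasi_abs2).
by rewrite !big_cons (le_trans (abs_extD av _ _)) // lerD2l.
Qed.

Lemma abs_ext_aut (u : {rmorphism algC -> algC}) : abs_extension v (a \o u).
Proof.
case: av => a_ge0 a_eq0 aM aD a_rat; split=> //= [x|x y|x y|q].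
- split=> [/a_eq0/eqP|->]; first by rewrite fmorph_eq0 => /eqP.
  by rewrite rmorph0; apply/a_eq0.
- by rewrite rmorphM.
- by rewrite rmorphD.
- by rewrite fmorph_rat.
Qed.

End AbsExtension.

Lemma abs_rat_nat (R : realType) (p : {p : nat | prime p}) (n : nat) :
  (0 < n)%N -> abs_rat R (Some p) n%:R = ((val p)%:R ^+ logn (val p) n)^-1.
Proof.
move=> n_gt0; rewrite /= pnatr_eq0 eqn0Ngt n_gt0 /=.
rewrite (_ : n%:R = n%:Z%:Q) // numq_int denq_int /= logn1 sub0r.
by rewrite -exprnN.
Qed.

Section Ultrametric.

Variables (R : realType) (p : {p : nat | prime p}) (a : algC -> R).
Hypothesis ap : abs_extension (Some p) a.

Lemma abs_nat_le1 n : a n%:R <= 1.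
Proof.
case: n => [|n]; first by rewrite (qabs0 (quasi_abs2 ap)).
rewrite (abs_ext_nat ap) abs_rat_nat // invf_le1.
  by rewrite exprn_ege1 // ler1n prime_gt0 // (valP p).
by rewrite exprn_gt0 // ltr0n prime_gt0 // (valP p).
Qed.

(** A p-adic absolute value is bounded on the integers, so the binomial
    theorem gives |x + y|^n <= (n + 1) max(|x|, |y|)^n for every n. *)
Lemma quasi_abs1 : quasi_abs 1 a.
Proof.
case: (ap) => a_ge0 a_eq0 aM aD _; split=> // x y; rewrite mul1r.
have qa2 := quasi_abs2 ap.
set M := Num.max _ _.
have M_ge0 : 0 <= M by rewrite le_max a_ge0.
have [M0|M_neq0] := eqVneq M 0.
  have x0 : x = 0 by apply/a_eq0/eqP; rewrite eq_le a_ge0 -M0 le_max lexx.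
  have y0 : y = 0 by apply/a_eq0/eqP; rewrite eq_le a_ge0 -M0 le_max lexx orbT.
  by rewrite x0 y0 addr0 (qabs0 qa2).
have M_gt0 : 0 < M by rewrite lt_def M_neq0.
rewrite -[leRHS]mul1r -ler_pdivrMr //; apply: expr_le_linear => n.
rewrite expr_div_n ler_pdivrMr ?exprn_gt0 // -(qabsX qa2) exprDn.
apply: le_trans (abs_ext_sum ap _ _) _.
rewrite -[n.+1 in leRHS]card_ord -sum1_card natr_sum mulr_suml.
apply: ler_sum => i _; rewrite -mulr_natr aM aM !(qabsX qa2) mul1r.
rewrite -[leRHS]mulr1 ler_pM ?mulr_ge0 ?exprn_ge0 ?abs_nat_le1 //.
rewrite -[n in leRHS](subnK (ltnSE (ltn_ord i))) exprD.
by rewrite ler_pM ?exprn_ge0 // lerXn2r ?nnegrE // le_max lexx ?orbT.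
Qed.

End Ultrametric.

Lemma quasi_abs_defect (R : realType) (d : nat) (v : place) (a : algC -> R) :
  abs_extension v a -> quasi_abs (defect R d v) a.
Proof.
rewrite /defect mem_places_upto; case: v => [p|] av; last exact: quasi_abs2 av.
by case: ifP => _; [apply: quasi_abs2 av|apply: quasi_abs1 av].
Qed.

(** In [places_upto d], |m| >= 1 / d >= 2^(-d); at the other places m is a unit. *)
Lemma defect_nat_ge1 (R : realType) (d : nat) (v : place) (a : algC -> R) :
  abs_extension v a ->
  forall m, (0 < m <= d)%N -> 1 <= defect R d v ^+ d * a m%:R.
Proof.
move=> av m /andP[m_gt0 m_le]; rewrite (abs_ext_nat av) /defect mem_places_upto.
case: v av => [p|] av; last first.
  have Nd : 1 <= (2 : R) ^+ d by rewrite exprn_ege1 // ler1n.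
  rewrite /= ratr_nat normr_nat; apply: le_trans Nd _.
  by rewrite ler_peMr ?exprn_ge0 // ler1n.
rewrite abs_rat_nat //; have p_gt0 : (0 < val p)%N := prime_gt0 (valP p).
case: leqP => [_|p_gt]; last first.
  rewrite lognE (valP p) m_gt0 /= gtnNdvd ?(leq_ltn_trans m_le) //.
  by rewrite expr0 invr1 mulr1 exprn_ege1.
rewrite ler_pdivlMr ?exprn_gt0 ?ltr0n // mul1r -!natrX ler_nat.
apply: leq_trans (dvdn_leq m_gt0 (pfactor_dvdnn _ _)) _.
by apply: leq_trans m_le (ltnW (ltn_expl d _)).
Qed.

Lemma sum_ln_defect (R : realType) (d : nat) (T : seq place) : uniq T ->
  \sum_(v <- T) ln (defect R d v) <= d.+2%:R.
Proof.
move=> uniqT; have ln2 : ln 2 <= 1 :> R.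
  by apply: (@le_ln1Dx R 1); apply: lt_trans (ltrN10 R) ltr01.
apply: le_trans (_ : \sum_(v <- T | v \in places_upto d) 1 <= _).
  rewrite [leRHS]big_mkcond; apply: ler_sum => v _; rewrite /defect.
  by case: ifP => _ //; rewrite ln1.
rewrite -big_filter big_const_seq count_predT iter_addr_0 ler_nat.
apply: leq_trans (size_places_upto d); apply: uniq_leq_size.
  by rewrite filter_uniq.
by move=> v; rewrite mem_filter => /andP[].
Qed.

(** A root of a monic rational polynomial is integral at every prime that does
    not divide the denominator of a coefficient. *)
Lemma abs_le1_almost_all (R : realType) (x : algC) :
  exists B : nat, forall (v : place) (a : algC -> R), abs_extension v a ->
    v \notin places_upto B -> a x <= 1.
Proof.
have [q [Dq mon_q] q_dvd] := minCpolyP x.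
have q_x : (map_poly ratr q).[x] = 0 by apply/eqP; rewrite -/(root _ _) q_dvd.
exists (\max_(i < size q) `|denq q`_i|)%N => v a av v_out.
move: v_out av; rewrite mem_places_upto; case: v => [p|] //; rewrite -ltnNge.
move=> p_gt ap; have qa := quasi_abs1 ap.
have p1 : 1 <= (val p)%:R :> R by rewrite ler1n prime_gt0 // (valP p).
have coef_le1 i : (i < size q)%N -> a (ratr q`_i) <= 1.
  move=> i_lt; rewrite (abs_ext_rat ap) /=; case: eqP => // _.
  have -> : logn (val p) `|denq q`_i| = 0%N.
    rewrite lognE gtnNdvd ?andbF ?absz_gt0 ?denq_neq0 //.
    by apply: leq_trans p_gt; rewrite ltnS; apply: 
      (@leq_bigmax _ (fun i : 'I_(size q) => `|denq q`_i|%N) (Ordinal i_lt)).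
  by rewrite sub0r -exprnN invf_le1 ?exprn_ege1 // exprn_gt0 // (lt_le_trans ltr01).
rewrite leNgt; apply/negP => x_gt1.
have x_gt0 := lt_trans ltr01 x_gt1.
have sz_q : size q = (size q).-1.+1 by rewrite prednK // lt0n size_poly_eq0 monic_neq0.
move: q_x; rewrite horner_coef size_map_poly sz_q big_ord_recr /=.
rewrite coef_map -lead_coefE (monicP mon_q) /= rmorph1 mul1r => /eqP.
rewrite addrC addr_eq0 => /eqP xn.
have [n_eq0|n_gt0] := posnP (size q).-1.
  move: xn; rewrite n_eq0 big_ord0 expr0 oppr0 => /eqP; exact/negP/oner_neq0.
have : a (x ^+ (size q).-1) <= 1 ^+ (size q).-1 * a x ^+ (size q).-2.
  rewrite xn (qabsN qa); apply: (qabs_sum_ord qa) => [|i]; first by rewrite exprn_ge0 // ltW.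
  rewrite coef_map (qabsM qa) (qabsX qa) -[leRHS]mul1r ler_pM ?exprn_ge0 ?(qabs_ge0 qa) //.
    by apply: coef_le1; apply: leq_trans (ltn_ord i) (leq_pred _).
  by rewrite ler_weXn2l ?(ltW x_gt1) // -ltnS prednK.
rewrite expr1n mul1r (qabsX qa) -{1}(prednK n_gt0) exprS.
by rewrite leNgt ltr_pMl ?x_gt1 ?exprn_gt0.
Qed.

(** * Heights as averages over automorphisms of algC *)

Section GaloisOrbit.

Variables (E : splittingFieldType rat) (iota : {rmorphism E -> algC}).

Local Notation G := 'Gal({:E} / 1%VS)%g.

Lemma dim_num_field : \dim {:E} = #|G|.
Proof.
have galE : galois 1%AS {:E}%AS.
  apply/and3P; split; [exact: sub1v| |exact: normalFieldf].
  apply/separableP => x _; apply: pcharf0_separable.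
  by apply/pcharf0P => n; rewrite -(fmorph_eq0 iota) rmorph_nat pnatr_eq0.
by rewrite -(galois_dim galE) dimv1 divn1.
Qed.

Lemma gal_extend (s : gal_of {:E}) :
  exists u : {rmorphism algC -> algC}, forall x, iota (s x) = u (iota x).
Proof.
by have [u us] := extend_algC_subfield_aut iota s; exists u.
Qed.

Lemma gal_restrict (u : {rmorphism algC -> algC}) :
  exists2 s : gal_of {:E}, s \in G & forall x, iota (s x) = u (iota x).
Proof.
have [f fu] := restrict_aut_to_normal_num_field iota u.
have kf : kHom 1 {:E} (linfun f).
  apply/kHomP; split=> [x y _ _|_ /vlineP[k ->]]; first by rewrite !lfunE /= rmorphM.
  by rewrite lfunE /= linearZ /= rmorph1.
have sub1 : (1 <= {:E} <= {:E})%VS by rewrite sub1v subvv.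
have [s sG fs] := kHom_to_gal sub1 (normalFieldf 1%AS) kf.
by exists s => // x; rewrite -fu -fs ?memvf // lfunE.
Qed.

Definition gal_orbit (ys : seq E) : seq (seq algC) :=
  [seq [seq iota (s y) | y <- ys] | s : gal_of {:E} in G].

(** Automorphisms of algC restrict to every Galois number field and every
    automorphism of such a field extends to algC, so the conjugates of a tuple
    of algebraic numbers do not depend on the field that contains them. *)
Lemma mem_gal_orbit ys w : w \in gal_orbit ys <->
  exists u : {rmorphism algC -> algC}, w = [seq u (iota y) | y <- ys].
Proof.
split=> [/fintype.imageP[s _ ->]|[u ->]].
  by have [u us] := gal_extend s; exists u; apply: eq_map.
have [s sG su] := gal_restrict u; apply/fintype.imageP; exists s => //.
by apply: eq_map => y; rewrite su.
Qed.

(** The orbit is listed with multiplicity: each of its elements appears as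
    many times as the stabiliser has elements. *)
Lemma count_gal_orbit ys w w' : w \in gal_orbit ys -> w' \in gal_orbit ys ->
  count_mem w (gal_orbit ys) = count_mem w' (gal_orbit ys).
Proof.
suff cnt s0 : s0 \in G -> count_mem [seq iota (s0 y) | y <- ys] (gal_orbit ys) =
    (\sum_(s in G | [seq s y | y <- ys] == ys) 1)%N.
  by move=> /fintype.imageP[s sG ->] /fintype.imageP[s' s'G ->]; rewrite !cnt.
move=> s0G; rewrite -sum1_count big_map big_enum_cond /=.
rewrite (reindex_inj (mulIg s0)) /=; apply: eq_bigl => s.
rewrite groupMr //; congr (_ && _).
have s0_inj : injective (fun y => iota (s0 y)).
  by move=> x y /fmorph_inj/fmorph_inj.
rewrite -(inj_eq (inj_map s0_inj)) -map_comp; congr (_ == _).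
by apply: eq_map => y /=; rewrite galM ?memvf.
Qed.

Definition gal_average (R : realType) (F : seq algC -> R) (ys : seq E) : R :=
  (\dim {:E})%:R^-1 * \sum_(s in G) F [seq iota (s y) | y <- ys].

(** The right-hand side involves only the set of conjugates of the tuple. *)
Lemma gal_averageE (R : realType) (F : seq algC -> R) ys :
  gal_average F ys =
  (size (undup (gal_orbit ys)))%:R^-1 * \sum_(w <- undup (gal_orbit ys)) F w.
Proof.
set L := gal_orbit ys; pose m := count_mem (head [::] L) L.
have w_L : [seq iota ((1%g : gal_of {:E}) y) | y <- ys] \in L.
  by apply: fintype.image_f; exact: group1.
have cnt w : w \in L -> count_mem w L = m.
  move=> wL; apply: count_gal_orbit => //; move: w_L; rewrite -/L.
  by case: (L) => //= x s _; rewrite mem_head.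
have m_gt0 : (0 < m)%N by rewrite -(cnt _ w_L) -has_count has_pred1.
have sumL (H : seq algC -> R) :
    \sum_(w <- L) H w = m%:R * \sum_(w <- undup L) H w.
  rewrite -big_undup_iterop_count mulr_sumr big_seq [RHS]big_seq.
  apply: eq_bigr => w; rewrite mem_undup => wL; rewrite cnt //.
  by rewrite Monoid.iteropE iter_addr_0 mulr_natl.
have szL : (\dim {:E})%:R = m%:R * (size (undup L))%:R :> R.
  rewrite dim_num_field.
  rewrite -(size_image (fun s : gal_of {:E} => [seq iota (s y) | y <- ys]) (mem G)).
  rewrite -/(gal_orbit ys) -/L -[size L]sum1_size natr_sum (sumL (fun=> 1)).
  by rewrite -[size (undup L)]sum1_size natr_sum.
have sumG : \sum_(s in G) F [seq iota (s y) | y <- ys] = \sum_(w <- L) F w.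
  by rewrite big_map big_enum.
rewrite /gal_average sumG szL sumL invfM -mulrA [_ * (m%:R * _)]mulrCA mulKf //.
by rewrite pnatr_eq0 -lt0n.
Qed.

End GaloisOrbit.

Lemma gal_average_indep (R : realType) (F : seq algC -> R)
    (E E' : splittingFieldType rat) (iota : {rmorphism E -> algC})
    (iota' : {rmorphism E' -> algC}) ys ys' :
  [seq iota y | y <- ys] = [seq iota' y | y <- ys'] ->
  gal_average iota F ys = gal_average iota' F ys'.
Proof.
move=> eq_ys.
have eq_orbit : undup (gal_orbit iota ys) =i undup (gal_orbit iota' ys').
  have map_u (D : splittingFieldType rat) (j : {rmorphism D -> algC}) zs
      (u : {rmorphism algC -> algC}) :
      [seq u (j z) | z <- zs] = [seq u x | x <- [seq j z | z <- zs]].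
    by rewrite -map_comp.
  move=> w; rewrite !mem_undup; apply/idP/idP => /mem_gal_orbit[u ->].
    by apply/mem_gal_orbit; exists u; rewrite !map_u eq_ys.
  by apply/mem_gal_orbit; exists u; rewrite !map_u eq_ys.
have orbit_perm := uniq_perm (undup_uniq _) (undup_uniq _) eq_orbit.
by rewrite !gal_averageE (perm_size orbit_perm) (perm_big _ orbit_perm).
Qed.

Lemma height_eq (R : realType) (abs : place -> algC -> R)
    (E : splittingFieldType rat) (iota : {rmorphism E -> algC}) (ys : seq E) :
  height abs [seq iota y | y <- ys] =
  (\dim {:E})%:R^-1 * \sum_(s in 'Gal({:E} / 1%VS)%g)
    \sum_(v \in [set: place]) ln (max1 (abs v) [seq iota (s y) | y <- ys]).
Proof.
rewrite /height; case: galois_field_exists => E' [iota' [ys' Dys]].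
transitivity (gal_average iota'
  (fun w => \sum_(v \in [set: place]) ln (max1 (abs v) w)) ys').
  rewrite /height_in /gal_average; congr (_ * _); apply: eq_bigr => s _.
  by apply: eq_fsbigr => v _; rewrite /max1 big_map.
by rewrite (gal_average_indep _ Dys).
Qed.

(** * Heights as finite sums over absolute values of algC *)

Section PlaceAverage.

Variables (R : realType) (us : seq {rmorphism algC -> algC}) (T : seq place).

Definition place_average (F : {rmorphism algC -> algC} -> place -> R) : R :=
  (size us)%:R^-1 * \sum_(u <- us) \sum_(v <- T) F u v.

Lemma place_averageD F G :
  place_average (fun u v => F u v + G u v) = place_average F + place_average G.
Proof.
rewrite /place_average -mulrDr -big_split; congr (_ * _).
by apply: eq_bigr => u _; rewrite -big_split.
Qed.

Lemma place_averageZ k F :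
  place_average (fun u v => k * F u v) = k * place_average F.
Proof.
rewrite /place_average [RHS]mulrCA [in RHS]mulr_sumr; congr (_ * _).
by apply: eq_bigr => u _; rewrite mulr_sumr.
Qed.

Lemma place_average_sum (I : Type) (s : seq I) F :
  place_average (fun u v => \sum_(i <- s) F i u v) =
    \sum_(i <- s) place_average (F i).
Proof.
elim: s => [|i s IHs].
  rewrite big_nil /place_average big1 ?mulr0 // => u _.
  by rewrite big1 // => v _; rewrite big_nil.
rewrite big_cons -IHs -place_averageD /place_average; congr (_ * _).
by apply: eq_bigr => u _; apply: eq_bigr => v _; rewrite big_cons.
Qed.

Lemma ler_place_average F G : (forall u v, F u v <= G u v) ->
  place_average F <= place_average G.
Proof.
move=> FG; rewrite /place_average ler_wpM2l ?invr_ge0 //.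
by apply: ler_sum => u _; apply: ler_sum => v _.
Qed.

Lemma place_average_defect d : uniq T -> (0 < size us)%N ->
  place_average (fun _ v => ln (defect R d v)) <= d.+2%:R.
Proof.
move=> uniqT us_gt0; rewrite /place_average ler_pdivrMl ?ltr0n //.
rewrite -sum1_size natr_sum mulr_suml; apply: ler_sum => u _.
by rewrite mul1r sum_ln_defect.
Qed.

End PlaceAverage.

Section FiniteHeight.

Variables (R : realType) (abs : place -> algC -> R).
Hypothesis abs_ext : forall v, abs_extension v (abs v).

Definition add_mul_closed (S : algC -> Prop) : Prop :=
  [/\ S 0, forall x y, S x -> S y -> S (x + y) &
      forall x y, S x -> S y -> S (x * y)].

(** S consists of the elements of a number field that are integral outside a
    finite set T of places. Each automorphism of the field is extended to algC,
    so that every term is an absolute value of algC; S contains the whole orbit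
    of a point under a polynomial with coefficients in S. *)
Lemma height_finite_sum (zs : seq algC) :
  exists us T (S : algC -> Prop),
    [/\ (0 < size us)%N, uniq T, forall z, z \in zs -> S z, add_mul_closed S &
        forall xs, (forall x, x \in xs -> S x) ->
          height abs xs =
            place_average us T (fun u v => ln (max1 (abs v \o u) xs))].
Proof.
have [E [iota [ys Dys]]] := galois_field_exists zs.
have [B BP] : exists B, forall z, z \in zs -> forall v (a : algC -> R),
    abs_extension v a -> v \notin places_upto B -> a z <= 1.
  elim: {ys Dys} zs => [|z zs [B BP]]; first by exists 0%N.
  have [B' B'P] := @abs_le1_almost_all R z; exists (maxn B B') => x.
  have sub (C : nat) v : (C <= maxn B B')%N ->
      v \notin places_upto (maxn B B') -> v \notin places_upto C.
    rewrite !mem_places_upto; case: v => // p C_le; rewrite -!ltnNge.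
    exact: leq_ltn_trans.
  rewrite inE => /predU1P[->|x_zs] v a av v_out.
    by apply: (B'P v a av); apply: sub v_out; apply: leq_maxr.
  by apply: (BP x x_zs v a av); apply: sub v_out; apply: leq_maxl.
set T := places_upto B in BP.
pose S x := (exists y, x = iota y) /\ forall v (a : algC -> R),
  abs_extension v a -> v \notin T -> a x <= 1.
pose aut s := sval (extend_algC_subfield_aut iota
  ((s : gal_of {:E}) : {rmorphism E -> E})).
have autP s x : aut s (iota x) = iota (s x).
  by rewrite /aut; case: (extend_algC_subfield_aut _ _) => u us /=; rewrite us.
pose G : seq (gal_of {:E}) := enum 'Gal({:E} / 1%VS)%g.
exists [seq aut s | s <- G], T, S; split.
- by rewrite size_map -cardE cardG_gt0.
- exact: places_upto_uniq.
- move=> z z_zs; split; last exact: BP.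
  by move: z_zs; rewrite -Dys => /mapP[y _ ->]; exists y.
- have ultra v (a : algC -> R) : abs_extension v a -> v \notin T -> quasi_abs 1 a.
    by case: v => [p|]; [move=> av _; exact: quasi_abs1 av|rewrite mem_head].
  split=> [|x y [[x' ->] Sx] [[y' ->] Sy]|x y [[x' ->] Sx] [[y' ->] Sy]].
  + split=> [|v a av _]; first by exists 0; rewrite rmorph0.
    by rewrite (qabs0 (quasi_abs2 av)).
  + split=> [|v a av vT]; first by exists (x' + y'); rewrite rmorphD.
    rewrite -[leRHS]mul1r; apply: (qabsD_le (ultra v a av vT)).
      exact: Sx av vT.
    exact: Sy av vT.
  + split=> [|v a av vT]; first by exists (x' * y'); rewrite rmorphM.
    have qa := quasi_abs2 av.
    by rewrite (qabsM qa) -[leRHS]mul1r ler_pM ?(qabs_ge0 qa) ?(Sx v) ?(Sy v).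
move=> xs xsS; have [ws Dxs] : exists ws, xs = [seq iota w | w <- ws].
  elim: xs xsS => [|x xs IHxs] xsS; first by exists [::].
  have [ws Dws] := IHxs (fun y ys => xsS y (mem_behead (s := x :: xs) ys)).
  by have [[w ->] _] := xsS x (mem_head _ _); exists (w :: ws); rewrite Dws.
rewrite {xs}Dxs in xsS *; have wsS w : w \in ws -> S (iota w).
  by move=> w_ws; apply: xsS; apply: map_f.
rewrite height_eq /place_average size_map -cardE -(dim_num_field iota).
congr (_ * _); rewrite big_map big_enum /=; apply: eq_bigr => s _.
rewrite -(fsbig_widen [set` T]) // => [|v /= [_ vT]].
  rewrite -fsbig_seq ?places_upto_uniq //; apply: eq_bigr => v _; congr ln.
  by rewrite /max1 !big_map; apply: eq_bigr => w _ /=; rewrite autP.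
have -> : max1 (abs v) [seq iota (s y) | y <- ws] = 1; last exact: ln1.
apply/eqP; rewrite eq_le max1_ge1 andbT; apply: max1_le => // x /mapP[w w_ws ->].
rewrite -autP; have [_ /(_ v (abs v \o aut s))] := wsS w w_ws.
by apply; [exact: abs_ext_aut|exact/negP].
Qed.

End FiniteHeight.

(** * Height inequalities for a polynomial map *)

Lemma add_mul_closed_horner (S : algC -> Prop) (p : {poly algC}) z :
  add_mul_closed S -> (forall x, x \in (p : seq algC) -> S x) -> S z -> S p.[z].
Proof.
case=> S0 SD SM; rewrite /horner; elim: (p : seq algC) => //= x s IHs Ss Sz.
apply: SD; last by apply: Ss; rewrite mem_head.
by apply: SM => //; apply: IHs => // y ys; apply: Ss; rewrite inE ys orbT.
Qed.

Lemma add_mul_closed_iter (S : algC -> Prop) (p : {poly algC}) z n :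
  add_mul_closed S -> (forall x, x \in (p : seq algC) -> S x) -> S z ->
  S (iter n (fun w => p.[w]) z).
Proof. by move=> clS Sp Sz; elim: n => //= n IHn; apply: add_mul_closed_horner. Qed.

Lemma le_ln (R : realType) (x y : R) : 0 < x -> x <= y -> ln x <= ln y.
Proof.
by move=> x0 xy; rewrite ler_ln // posrE // (lt_le_trans x0).
Qed.

Section HeightInequalities.

Variables (R : realType) (abs : place -> algC -> R).
Hypothesis abs_ext : forall v, abs_extension v (abs v).

Let qabs d v (u : {rmorphism algC -> algC}) :
  quasi_abs (defect R d v) (abs v \o u).
Proof. exact: quasi_abs_defect (abs_ext_aut (abs_ext v) u). Qed.

Let qnat d v (u : {rmorphism algC -> algC}) :
  forall m, (0 < m <= d)%N -> 1 <= defect R d v ^+ d * (abs v \o u) m%:R.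
Proof. exact: defect_nat_ge1 (abs_ext_aut (abs_ext v) u). Qed.

Lemma defect_gt0 d v : 0 < defect R d v.
Proof. by rewrite /defect; case: ifP. Qed.

Lemma height_ge0 xs : 0 <= height abs xs.
Proof.
have [us [T [S [_ _ Sxs _ ->]]]] := height_finite_sum abs_ext xs => //.
rewrite /place_average mulr_ge0 ?invr_ge0 //.
by apply: sumr_ge0 => u _; apply: sumr_ge0 => v _; rewrite ln_ge0 // max1_ge1.
Qed.

Lemma height_horner (p : {poly algC}) n z : (size p <= n.+1)%N ->
  height abs [:: p.[z]] <=
    n%:R * height abs [:: z] + (height abs p + (2 * n.+1)%:R).
Proof.
move=> sz_p.
have [us [T [S [us_gt0 uniqT S_zs clS hS]]]] := height_finite_sum abs_ext (z :: p).
have Sz : S z by apply: S_zs; rewrite mem_head.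
have Sp x : x \in (p : seq algC) -> S x by move=> xp; apply: S_zs; rewrite inE xp orbT.
have Spz : S p.[z] by apply: add_mul_closed_horner.
rewrite !hS // => [|x|x]; try by rewrite inE => /eqP ->.
apply: le_trans (_ : place_average us T (fun u v =>
    n%:R * ln (max1 (abs v \o u) [:: z]) +
    (ln (max1 (abs v \o u) p) + n.+1%:R * ln (defect R 0 v))) <= _).
  apply: ler_place_average => u v.
  apply: le_trans (le_ln (max1_gt0 _ _) (max1_horner (qabs 0 v u) z sz_p)) _.
  rewrite !lnM ?posrE ?mulr_gt0 ?exprn_gt0 ?defect_gt0 ?max1_gt0 //.
  rewrite !lnXn ?defect_gt0 ?max1_gt0 // !mulr_natl.
  by rewrite addrC [X in X + _]addrC addrA.
rewrite !place_averageD !place_averageZ !lerD2l mulnC natrM ler_wpM2l //.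
exact: place_average_defect.
Qed.

(** The factors 1 and 0 that complete the coefficients of a monic centred
    polynomial do not change the local maxima. *)
Lemma height_monic_centred d (g : {poly algC}) :
  (1 < d)%N -> size g = d.+1 -> g \is monic -> g`_d.-1 = 0 ->
  height abs [seq g`_i | i <- rev (iota 0 d.-1)] = height abs g.
Proof.
move=> d_gt1 sz_g mon_g g_d1.
have [us [T [S [_ _ S_g clS hS]]]] := height_finite_sum abs_ext g.
have [S0 _ _] := clS.
rewrite !hS // => [|x /mapP[i _ ->]]; last first.
  have [i_lt|i_ge] := ltnP i (size g); first by apply: S_g; apply: mem_nth.
  by rewrite nth_default.
rewrite /place_average; congr (_ * _); apply: eq_bigr => u _.
apply: eq_bigr => v _; congr ln; have qa := qabs 0 v u.
apply/eqP; rewrite eq_le; apply/andP; split.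
  apply: max1_sub => x /mapP[i]; rewrite mem_rev mem_iota => /andP[_ i_lt] ->.
  by apply: mem_nth; rewrite sz_g; lia.
apply: max1_le; first exact: max1_ge1.
move=> x /(nthP 0)[i]; rewrite sz_g => i_lt <-.
have [i_small|i_big] := ltnP i d.-1.
  by apply: max1_ge; apply: map_f; rewrite mem_rev mem_iota.
have [->|i_neq] := eqVneq i d.-1.
  by rewrite g_d1 (qabs0 qa) max1_ge0.
have -> : i = (size g).-1 by rewrite sz_g /=; lia.
by rewrite -lead_coefE (monicP mon_g) (qabs1 qa) max1_ge1.
Qed.

Variables (d : nat) (rs cs : seq algC) (g : {poly algC}).
Hypotheses (d_gt1 : (1 < d)%N) (Dg : g = \prod_(r <- rs) ('X - r%:P))
  (sz_rs : d = size rs) (sz_cs : d = (size cs).+1)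
  (sum_rs : \sum_(r <- rs) r = 0)
  (der_g : g^`() = d%:R *: \prod_(c <- cs) ('X - c%:P)).

(** The coefficients are the elementary symmetric functions of the d roots. *)
Lemma height_le_roots :
  height abs g <= d%:R * (height abs rs + d.+2%:R).
Proof.
have [us [T [S [us_gt0 uniqT S_zs clS hS]]]] := height_finite_sum abs_ext (rs ++ g).
have Srs x : x \in rs -> S x by move=> xrs; apply: S_zs; rewrite mem_cat xrs.
have Sg x : x \in (g : seq algC) -> S x.
  by move=> xg; apply: S_zs; rewrite mem_cat xg orbT.
rewrite (hS g Sg) (hS rs Srs).
apply: le_trans (_ : place_average us T (fun u v =>
    d%:R * (ln (max1 (abs v \o u) rs) + ln (defect R d v))) <= _).
  apply: ler_place_average => u v.
  have := max1_coef_le_roots (qabs d v u) rs; rewrite -Dg -sz_rs => le_g.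
  apply: le_trans (le_ln (max1_gt0 _ _) le_g) _.
  rewrite lnM ?posrE ?exprn_gt0 ?defect_gt0 ?max1_gt0 //.
  by rewrite !lnXn ?defect_gt0 ?max1_gt0 // !mulr_natl mulrnDl addrC.
rewrite place_averageZ place_averageD ler_wpM2l // lerD2l.
exact: place_average_defect.
Qed.

Lemma sum_height_critical_le :
  \sum_(c <- cs) height abs [:: c] <=
    height abs g + ((d * d + 2 * d) * d.+2)%:R.
Proof.
have [us [T [S [us_gt0 uniqT S_zs clS hS]]]] := height_finite_sum abs_ext (cs ++ g).
have Scs x : x \in cs -> S x by move=> xcs; apply: S_zs; rewrite mem_cat xcs.
have Sg x : x \in (g : seq algC) -> S x.
  by move=> xg; apply: S_zs; rewrite mem_cat xg orbT.
have hc c : c \in cs ->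
    height abs [:: c] = place_average us T (fun u v => ln (max1 (abs v \o u) [:: c])).
  by move=> c_cs; apply: hS => x; rewrite inE => /eqP ->; apply: Scs.
rewrite (hS g Sg) big_seq (eq_bigr _ hc) -big_seq -place_average_sum.
apply: le_trans (_ : place_average us T (fun u v =>
    ln (max1 (abs v \o u) g) + (d * d + 2 * d)%:R * ln (defect R d v)) <= _).
  apply: ler_place_average => u v.
  have sz_g : (size g <= d.+1)%N by rewrite Dg size_prod_XsubC sz_rs.
  have le_cs := prod_max1_critical_le (qabs d v u) (qnat v u) sz_cs sz_g der_g.
  have prod_gt0 (s : seq algC) : 0 < \prod_(c <- s) max1 (abs v \o u) [:: c].
    by apply: prodr_gt0 => c _; apply: max1_gt0.
  move: (le_ln (prod_gt0 cs) le_cs); rewrite lnM ?posrE ?exprn_gt0 ?defect_gt0 ?max1_gt0 //.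
  rewrite lnXn ?defect_gt0 // mulr_natl addrC; apply: le_trans.
  rewrite le_eqVlt; apply/orP; left; apply/eqP.
  elim: (cs) => [|c s IHs]; first by rewrite !big_nil ln1.
  by rewrite !big_cons lnM ?posrE ?max1_gt0 ?prod_gt0 // IHs.
rewrite place_averageD place_averageZ lerD2l natrM ler_wpM2l //.
exact: place_average_defect.
Qed.

(** At each absolute value the escaping critical point alone accounts for the
    bound, which critical point depending on the absolute value; the other
    terms are nonnegative. *)
Lemma sum_height_orbit_ge k :
  height abs rs - ((gap_exp d + 3) * d.+2)%:R <=
    \sum_(c <- cs) d%:R ^- k.+1 * height abs [:: iter k.+1 (fun w => g.[w]) c].
Proof.
have [us [T [S [us_gt0 uniqT S_zs clS hS]]]] :=
  height_finite_sum abs_ext (rs ++ cs ++ g).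
have Srs x : x \in rs -> S x by move=> xrs; apply: S_zs; rewrite mem_cat xrs.
have Scs x : x \in cs -> S x.
  by move=> xcs; apply: S_zs; rewrite !mem_cat xcs orbT.
have Sg x : x \in (g : seq algC) -> S x.
  by move=> xg; apply: S_zs; rewrite !mem_cat xg !orbT.
have hc c : c \in cs ->
    d%:R ^- k.+1 * height abs [:: iter k.+1 (fun w => g.[w]) c] =
    place_average us T (fun u v => d%:R ^- k.+1 *
      ln (max1 (abs v \o u) [:: iter k.+1 (fun w => g.[w]) c])).
  move=> c_cs; rewrite place_averageZ hS // => x.
  by rewrite inE => /eqP ->; apply: add_mul_closed_iter => //; apply: Scs.
rewrite (hS rs Srs) [leRHS]big_seq (eq_bigr _ hc) -big_seq -place_average_sum.
rewrite lerBlDr.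
apply: le_trans (_ : place_average us T (fun u v =>
    \sum_(c <- cs) d%:R ^- k.+1 *
      ln (max1 (abs v \o u) [:: iter k.+1 (fun w => g.[w]) c]) +
    (gap_exp d + 3)%:R * ln (defect R d v)) <= _); last first.
  rewrite place_averageD place_averageZ lerD2l natrM ler_wpM2l //.
  exact: place_average_defect.
apply: ler_place_average => u v; rewrite -lerBlDr.
have der_f := der_g; rewrite Dg in der_f.
have [c c_cs esc] :=
  critical_escape (qabs d v u) (qnat v u) sz_rs sz_cs d_gt1 sum_rs der_f.
rewrite -Dg in esc; apply: le_trans (esc k) _.
rewrite (big_rem c) //= lerDl; apply: sumr_ge0 => c' _.
by rewrite mulr_ge0 ?invr_ge0 ?exprn_ge0 // ln_ge0 // max1_ge1.
Qed.

End HeightInequalities.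

(** * Canonical heights *)

Section ScaledLimit.

Local Open Scope classical_set_scope.

Variables (R : realType) (d : nat).
Hypothesis d_gt1 : (1 < d)%N.

Let d_gt0 : 0 < d%:R :> R. Proof. by rewrite ltr0n ltnW. Qed.

Lemma cvg_expVn : (fun n => d%:R ^- n : R) @ \oo --> (0 : R).
Proof.
under eq_fun do rewrite -exprVn.
apply: cvg_expr; rewrite ger0_norm ?invr_ge0 ?ler0n //.
by rewrite invf_lt1 // ltr1n.
Qed.

(** Adding C / (d - 1) d^(-n) makes the scaled sequence decreasing, so the
    upper bound on h (n + 1) alone gives convergence. *)
Lemma scaled_limit (h : nat -> R) (C : R) : 0 <= C -> (forall n, 0 <= h n) ->
  (forall n, h n.+1 <= d%:R * h n + C) ->
  cvgn (fun n => d%:R ^- n * h n) /\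
  limn (fun n => d%:R ^- n * h n) <= h 0%N + C / d.-1%:R.
Proof.
move=> C0 h0 hS; pose K := C / d.-1%:R.
have d1_gt0 : 0 < d.-1%:R :> R by rewrite ltr0n -ltnS prednK // ltnW.
have K0 : 0 <= K by rewrite divr_ge0 // ltW.
have dK : C + K = d%:R * K.
  rewrite -[in RHS](prednK (ltnW d_gt1)) -natr1 mulrDl mul1r; congr (_ + _).
  by rewrite /K mulrC divfK ?gt_eqF.
pose w n := d%:R ^- n * (h n + K).
have wS n : w n.+1 <= w n.
  rewrite /w exprS invfM -mulrA mulrCA ler_wpM2l ?invr_ge0 ?exprn_ge0 //.
  rewrite ler_pdivrMl // mulrDr -dK addrA lerD2r; exact: hS.
have w_dec : {homo w : n m / (n <= m)%N >-> m <= n}.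
  by apply/nonincreasing_seqP.
have w_cvg : cvgn w.
  apply: nonincreasing_is_cvgn => //; exists 0 => _ [n _ <-].
  by rewrite mulr_ge0 ?invr_ge0 ?exprn_ge0 // addr_ge0.
have hw : (fun n => d%:R ^- n * h n) @ \oo --> limn w.
  rewrite -[limn w](subr0) -(mulr0 K).
  have -> : (fun n => d%:R ^- n * h n) = (fun n => w n - K * d%:R ^- n).
    by apply/funext => n; rewrite /w mulrDr [K * _]mulrC addrK.
  by apply: cvgB => //; apply: cvgMr; exact: cvg_expVn.
split; first by apply/cvg_ex; exists (limn w).
rewrite (cvg_lim _ hw) //; apply: le_trans (nonincreasing_cvgn_ge w_dec w_cvg 0%N) _.
by rewrite /w expr0 invr1 mul1r.
Qed.

Lemma scaled_limit_eq (h h' : nat -> R) (K : R) :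
  cvgn (fun n => d%:R ^- n * h n) ->
  (forall n, h' n <= h n + K) -> (forall n, h n <= h' n + K) ->
  limn (fun n => d%:R ^- n * h' n) = limn (fun n => d%:R ^- n * h n).
Proof.
move=> h_cvg h'h hh'; apply: cvg_lim => //.
have K_cvg : (fun n => K * d%:R ^- n) @ \oo --> (0 : R).
  by rewrite -(mulr0 K); apply: cvgMr; exact: cvg_expVn.
apply: (@squeeze_cvgr _ _ _ _ (fun n => d%:R ^- n * h n - K * d%:R ^- n)
  (fun n => d%:R ^- n * h n + K * d%:R ^- n)).
- near=> n; rewrite [K * _]mulrC -mulrDr -mulrBr.
  by rewrite !ler_wpM2l ?invr_ge0 ?exprn_ge0 ?lerBlDr.
- by rewrite -[X in _ --> X]subr0; apply: cvgB.
- by rewrite -[X in _ --> X]addr0; apply: cvgD.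
Unshelve. all: by end_near.
Qed.

Lemma cvg_sum_seq (I : eqType) (s : seq I) (f : I -> nat -> R)
    (l : I -> R) :
  (forall i, i \in s -> f i @ \oo --> l i) ->
  (fun n => \sum_(i <- s) f i n) @ \oo --> \sum_(i <- s) l i.
Proof.
elim: s => [|i s IHs] f_cvg.
  under eq_fun do rewrite big_nil.
  by rewrite big_nil; exact: cvg_cst.
under eq_fun do rewrite big_cons.
rewrite big_cons; apply: cvgD; first by apply: f_cvg; rewrite mem_head.
by apply: IHs => j js; apply: f_cvg; rewrite inE js orbT.
Qed.

End ScaledLimit.

(** * The critical height as a sum over the zeros of the derivative *)

(** In characteristic 0 differentiation lowers the multiplicity of a zero by
    exactly one. *)
Lemma mup_deriv (z : algC) (f : {poly algC}) : (1 < size f)%N ->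
  mup z (f - f.[z]%:P) = (mup z f^`()).+1.
Proof.
move=> f_gt1; set p := f - _.
have sz_p : size p = size f.
  by rewrite size_polyDl // size_polyN (leq_ltn_trans (size_polyC_leq1 _)).
have p_neq0 : p != 0 by rewrite -size_poly_gt0 sz_p ltnW.
have -> : f^`() = p^`() by rewrite derivB derivC subr0.
have p_z : root p z by rewrite /root hornerD hornerN hornerC subrr.
have [m [q q_z Dp]] := multiplicity_XsubC p z.
rewrite p_neq0 /= in q_z.
have q_neq0 : q != 0 by apply: contraNneq q_z => ->; rewrite root0.
have m_gt0 : (0 < m)%N.
  by case: m Dp => // Dp; move: p_z; rewrite Dp expr0 mulr1 (negPf q_z).
have mup_pow n : mup z (('X - z%:P) ^+ n) = n by rewrite mup_XsubCX eqxx.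
rewrite Dp mupMr // mup_pow derivM deriv_exp derivXsubC.
rewrite -(prednK m_gt0) /= exprS.
set y := 'X - z%:P.
have -> : q^`() * (y * y ^+ m.-1) + q * (1 * y ^+ m.-1 *+ m.-1.+1) =
  (q^`() * y + q *+ m.-1.+1) * y ^+ m.-1.
  by rewrite -mulr_natr -[q *+ _]mulr_natr; ring.
rewrite mupMr ?mup_pow //; rewrite /root hornerD hornerM hornerXsubC subrr mulr0.
by rewrite add0r hornerMn mulrn_eq0.
Qed.

Lemma critical_height_sum (R : realType) (abs : place -> algC -> R)
    (f : {poly algC}) (k : algC) (cs : seq algC) :
  (1 < size f)%N -> k != 0 -> f^`() = k *: \prod_(c <- cs) ('X - c%:P) ->
  critical_height_poly abs f = \sum_(c <- cs) canonical_height abs f c.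
Proof.
move=> f_gt1 k_neq0 der_f.
pose F (P : option algC) : R :=
  ((ramification_index f P)%:R - 1) * canonical_height_P1 abs f P.
have F_Some z : F (Some z) = canonical_height abs f z *+ count_mem z cs.
  rewrite /F /= mup_deriv // der_f -mul_polyC mupMr ?mu_prod_XsubC; last first.
    by rewrite rootC.
  by rewrite -natr1 addrK mulr_natl.
rewrite /critical_height_poly -/F.
pose cs' := [seq Some c | c <- undup cs].
have Some_inj : injective (@Some algC) by move=> x y [].
rewrite -(@fsbig_widen _ _ _ _ [set` cs']%classic) //; last first.
  move=> [z|] /= [_ z_out]; last by rewrite /= mulr0.
  rewrite -[LHS]/(F (Some z)) F_Some (_ : count_mem z cs = 0%N) ?mulr0n //.
  apply/count_memPn/negP => z_cs; apply: z_out.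
  by rewrite mem_map // mem_undup.
rewrite -fsbig_seq ?map_inj_uniq ?undup_uniq // big_map.
rewrite (eq_bigr _ (fun z _ => F_Some z)).
rewrite -[RHS]big_undup_iterop_count; apply: eq_bigr => c _.
by rewrite Monoid.iteropE iter_addr_0.
Qed.

(** * Invariance under affine conjugacy *)

Section CanonicalHeight.

Variables (R : realType) (abs : place -> algC -> R).
Hypothesis abs_ext : forall v, abs_extension v (abs v).

Lemma canonical_height_cvg (g : {poly algC}) d z : (1 < d)%N -> size g = d.+1 ->
  cvgn (fun n => d%:R ^- n * height abs [:: iter n (fun w => g.[w]) z] : R) /\
  canonical_height abs g z <=
    height abs [:: z] + (height abs g + (2 * d.+1)%:R) / d.-1%:R.
Proof.
move=> d_gt1 sz_g; rewrite /canonical_height sz_g.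
apply: (scaled_limit d_gt1 (h := fun n => height abs [:: iter n (fun w => g.[w]) z])).
- by rewrite addr_ge0 ?height_ge0.
- by move=> n; apply: height_ge0.
- by move=> n; apply: height_horner; rewrite ?sz_g.
Qed.

(** An affine change of variable alters heights by a bounded amount, which the
    division by d^n makes disappear in the limit. *)
Lemma canonical_height_conj (f g : {poly algC}) d (a b z : algC) :
  (1 < d)%N -> size f = d.+1 -> size g = d.+1 -> a != 0 ->
  (forall w, f.[a * w + b] = a * g.[w] + b) ->
  canonical_height abs f (a * z + b) = canonical_height abs g z.
Proof.
move=> d_gt1 sz_f sz_g a_neq0 fg; rewrite /canonical_height sz_f sz_g /=.
have [g_cvg _] := canonical_height_cvg z d_gt1 sz_g.
have iter_f n : iter n (fun w => f.[w]) (a * z + b) =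
    a * iter n (fun w => g.[w]) z + b.
  by elim: n => //= n ->; rewrite fg.
have sz_lin (x y : algC) : (size (x *: 'X + y%:P)%R <= 2)%N.
  rewrite (leq_trans (size_polyD _ _)) // geq_max.
  rewrite (leq_trans (size_scale_leq _ _)) ?size_polyX //.
  by rewrite (leq_trans (size_polyC_leq1 _)).
have lin (x y w : algC) : (x *: 'X + y%:P).[w] = x * w + y.
  by rewrite hornerD hornerZ hornerX hornerC.
pose K p : R := height abs (p : {poly algC}) + (2 * 2)%:R.
have K0 p : 0 <= K p by rewrite addr_ge0 ?height_ge0.
pose A := a *: 'X + b%:P; pose B := a^-1 *: 'X + (- (a^-1 * b))%:P.
apply: (scaled_limit_eq d_gt1 (K := K A + K B) g_cvg) => n; rewrite iter_f.
  rewrite -lin; apply: le_trans (height_horner abs_ext _ (sz_lin a b)) _.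
  by rewrite mul1r -/A -/(K A) lerD2l lerDl.
set w := iter n _ z; rewrite -{1}(_ : B.[a * w + b] = w); last first.
  by rewrite lin mulrDr mulKf // addrK.
apply: le_trans (height_horner abs_ext _ (sz_lin _ _)) _.
by rewrite mul1r -/B -/(K B) lerD2l lerDr.
Qed.

Lemma critical_height_conj (f g : {poly algC}) d (a b : algC) (cs : seq algC) :
  (1 < d)%N -> size f = d.+1 -> size g = d.+1 -> a != 0 ->
  g = conjugate a b f ->
  g^`() = d%:R *: \prod_(c <- cs) ('X - c%:P) ->
  critical_height_poly abs f = \sum_(c <- cs) canonical_height abs g c.
Proof.
move=> d_gt1 sz_f sz_g a_neq0 Dg der_g.
have AgB : f = affine a b \Po (g \Po affine_inv a b).
  rewrite Dg /conjugate !comp_polyA affine_invr // comp_polyX.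
  by rewrite -comp_polyA affine_invr // comp_polyXr.
have fg w : f.[a * w + b] = a * g.[w] + b.
  have affE x y z : (affine x y).[z] = x * z + y :> algC.
    by rewrite /affine hornerD hornerZ hornerX hornerC.
  rewrite -[a * w + b]affE -horner_comp AgB -!comp_polyA.
  by rewrite affine_invl // comp_polyXr horner_comp affE.
have ai_neq0 : a^-1 != 0 by rewrite invr_eq0.
have der_f : f^`() = (d%:R * a^-1 ^+ size cs) *:
    \prod_(c <- [seq a * c + b | c <- cs]) ('X - c%:P).
  have affD x y : (affine x y)^`() = x%:P.
    by rewrite /affine derivD derivZ derivX derivC addr0 -mul_polyC mulr1.
  rewrite AgB !deriv_comp /affine_inv !affD comp_polyC -/(affine_inv a b).
  rewrite [_ * a^-1%:P]mulrC mulrA -polyCM mulfV // mul1r der_g comp_polyZ.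
  rewrite /affine_inv /affine comp_prod_XsubC_affine // scalerA big_map.
  congr (_ *: _); apply: eq_bigr => c _; congr ('X - _%:P).
  by rewrite opprK invrK mulrDl [a^-1 * b]mulrC divfK // mulrC.
rewrite (critical_height_sum _ _ _ der_f) ?sz_f 1?ltnS ?(ltnW d_gt1) //.
  rewrite big_map; apply: eq_bigr => c _.
  exact: canonical_height_conj d_gt1 sz_f sz_g a_neq0 fg.
by rewrite mulf_neq0 ?expf_neq0 // pnatr_eq0 -lt0n ltnW.
Qed.

Lemma monic_centred_factors (g : {poly algC}) d :
  (1 < d)%N -> size g = d.+1 -> g \is monic -> g`_d.-1 = 0 ->
  exists rs cs, [/\ g = \prod_(r <- rs) ('X - r%:P), d = size rs,
    d = (size cs).+1, \sum_(r <- rs) r = 0 &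
    g^`() = d%:R *: \prod_(c <- cs) ('X - c%:P)].
Proof.
move=> d_gt1 sz_g mon_g g_d1; have d_gt0 := ltnW d_gt1.
have [rs Dg] := closed_field_poly_normal g.
rewrite (monicP mon_g) scale1r in Dg.
have sz_rs : d = size rs by apply/succn_inj; rewrite -sz_g Dg size_prod_XsubC.
have g_d : g`_d = 1 by rewrite -(monicP mon_g) lead_coefE sz_g.
have d_neq0 : d%:R != 0 :> algC by rewrite pnatr_eq0 -lt0n.
have der_d1 : g^`()`_d.-1 = d%:R by rewrite coef_deriv prednK // g_d.
have sz_der : size g^`() = d.
  apply/anti_leq/andP; split.
    by rewrite -ltnS -sz_g lt_size_deriv // -size_poly_gt0 sz_g.
  rewrite leqNgt; apply/negP => sz_lt; case/negP: d_neq0.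
  by rewrite -der_d1 nth_default // -ltnS prednK.
have [cs Dder] := closed_field_poly_normal g^`().
rewrite lead_coefE sz_der der_d1 in Dder.
exists rs, cs; split => //.
  by rewrite -sz_der Dder size_scale // size_prod_XsubC.
apply/eqP; rewrite -oppr_eq0 -coefPn_prod_XsubC -?sz_rs //.
  by rewrite -Dg g_d1.
by rewrite -lt0n.
Qed.

End CanonicalHeight.

(** * The comparison *)

(** The losses of [sum_height_orbit_ge] and, divided by d, of
    [height_le_roots]. *)
Definition lower_const (d : nat) : nat :=
  ((gap_exp d + 3) * d.+2 + d.+2)%N.

(** The losses of [sum_height_critical_le] and, for the d - 1 critical points
    together, of [height_horner]. *)
Definition upper_const (d : nat) : nat :=
  ((d * d + 2 * d) * d.+2 + 2 * d.+1)%N.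

Theorem theorem1 (R : realType) :
  exists C1 C2 : nat -> R,
    effectively_computable C1 /\ effectively_computable C2 /\
    forall (d : nat), (2 <= d)%N ->
    forall (abs : place -> algC -> R), (forall v : place, abs_extension v (abs v)) ->
    forall f : moduli d,
      1 / (2 * d%:R - 1) * h_mc abs f - C1 d <= h_crit abs f /\
      h_crit abs f <= 4 * h_mc abs f + C2 d.
Proof.
exists (fun d => (lower_const d)%:R), (fun d => (upper_const d)%:R).
split; [|split].
- apply: nat_effectively_computable; rewrite /lower_const /gap_exp /scale_exp.
  by do !(exact: Rec_proj || exact: recursive_const || apply: recursive_exp
    || apply: recursive_mul || apply: recursive_add || apply: recursive_succ).
- apply: nat_effectively_computable; rewrite /upper_const.
  by do !(exact: Rec_proj || exact: recursive_const || apply: recursive_exp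
    || apply: recursive_mul || apply: recursive_add || apply: recursive_succ).
move=> d d_gt1 abs abs_ext F.
have [[mon_g g_d1] piF] := mc_reprP F d_gt1.
rewrite /h_crit /h_mc; set G := mc_repr F in mon_g g_d1 piF *.
set g := val G in mon_g g_d1 *; set f := val (repr F).
have sz_g : size g = d.+1 := eqP (valP G).
have sz_f : size f = d.+1 := eqP (valP (repr F)).
have /asboolP[a [b [a_neq0 Dg]]] : affine_conj (repr F) G.
  by rewrite -eqmodE piF; apply/eqP; rewrite reprK.
have [rs [cs [Drs sz_rs sz_cs sum_rs der_g]]] :=
  monic_centred_factors d_gt1 sz_g mon_g g_d1.
rewrite (critical_height_conj abs_ext d_gt1 sz_f sz_g a_neq0 Dg der_g).
rewrite (height_monic_centred abs_ext d_gt1 sz_g mon_g g_d1).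
have d_gt0 : 0 < d%:R :> R by rewrite ltr0n ltnW.
have hg0 := height_ge0 abs_ext g.
split.
  have le_orbit : height abs rs - ((gap_exp d + 3) * d.+2)%:R <=
      \sum_(c <- cs) canonical_height abs g c.
    have sum_cvg : ((fun n => \sum_(c <- cs)
        d%:R ^- n * height abs [:: iter n (fun w => g.[w]) c]) @ \oo -->
        \sum_(c <- cs) canonical_height abs g c)%classic.
      apply: cvg_sum_seq => c _; rewrite /canonical_height sz_g.
      by have [] := canonical_height_cvg abs_ext c d_gt1 sz_g.
    rewrite -(cvg_lim _ sum_cvg) //; apply: limr_ge.
      by apply/cvg_ex; eexists; exact: sum_cvg.
    near=> n; have n_gt0 : (0 < n)%N by near: n; exact: nbhs_infty_gt.
    rewrite -(prednK n_gt0).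
    exact: (sum_height_orbit_ge abs_ext d_gt1 Drs sz_rs sz_cs sum_rs der_g).
  have le_g := height_le_roots abs_ext Drs sz_rs.
  (* The argument yields the constant 1 / d, and d <= 2 d - 1. *)
  have le_inv : 1 / (2 * d%:R - 1) * height abs g <= d%:R^-1 * height abs g.
    have d1 : 1 <= d%:R :> R by rewrite ler1n ltnW.
    by rewrite ler_wpM2r // div1r lef_pV2 ?posrE; lra.
  have {}le_g : d%:R^-1 * height abs g <= height abs rs + d.+2%:R.
    by rewrite ler_pdivrMl.
  rewrite /lower_const natrD; lra.
have le_each c : c \in cs -> canonical_height abs g c <=
    height abs [:: c] + (height abs g + (2 * d.+1)%:R) / d.-1%:R.
  by move=> _; have [_] := canonical_height_cvg abs_ext c d_gt1 sz_g.
have le_cs := sum_height_critical_le abs_ext Drs sz_rs sz_cs der_g.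
(* The d - 1 critical points cancel the denominator d - 1 of the difference
   between canonical and ordinary heights. *)
apply: le_trans (_ : \sum_(c <- cs) (height abs [:: c] +
    (height abs g + (2 * d.+1)%:R) / d.-1%:R) <= _).
  by rewrite big_seq [leRHS]big_seq; apply: ler_sum.
rewrite big_split /= (_ : \sum_(c <- cs) _ / _ = height abs g + (2 * d.+1)%:R).
  rewrite /upper_const natrD; lra.
rewrite big_const_seq count_predT iter_addr_0 -[LHS]mulr_natr.
have -> : size cs = d.-1 by rewrite [in RHS]sz_cs.
by rewrite divfK // pnatr_eq0 -lt0n -ltnS prednK // ltnW.
Unshelve. all: by end_near.
Qed.
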